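(* Let $m,n \in \mathbb{N}$, $\alpha>0$, let $A \in \mathbb{C}^{n \times n}$ be normal, let $\{\boldsymbol{\varphi}^{(1)},\ldots,\boldsymbol{\varphi}^{(n)}\}$ be an orthonormal eigenbasis of $A$, and let $\boldsymbol{b}\in\mathbb{C}^n$ be nonzero. Then $$d_{H}\big(W(H_{6m+1}),W(A) \big) \le \frac{6}{m} \ln \bigg( \frac{e\,m\, \|\boldsymbol{b}\|^2_2 }{6 \min_{j \in [n]} |\langle \boldsymbol{b}, \boldsymbol{\varphi}^{(j)} \rangle |^2}\bigg) \, \mathrm{diam}(W(A)) .$$ In particular, if $\boldsymbol{b} \sim \mathrm{Unif}(\mathbb{S}^{n-1})$, then $$\mathbb{P}\bigg[ \frac{d_{H}\big(W(H_{6m+1}),W(A) \big)}{\mathrm{diam}(W(A)) } \le \frac{6(2+\alpha) \ln n}{m} \bigg] \ge 1 - \frac{5m}{4n^{\alpha}}.$$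
   Context: $\mathbb{N}$ denotes the positive integers and $[n]=\{1,\dots,n\}$. The numerical range of a square matrix $M\in\mathbb{C}^{k\times k}$ is $W(M)=\{\boldsymbol{x}^*M\boldsymbol{x}/\boldsymbol{x}^*\boldsymbol{x} : \boldsymbol{x}\in\mathbb{C}^k\setminus\{0\}\}$. For $A\in\mathbb{C}^{n\times n}$, nonzero $\boldsymbol{b}\in\mathbb{C}^n$ and $k\in\mathbb{N}$, the Krylov subspace is $\mathcal{K}_k(A,\boldsymbol{b})=\mathrm{span}\{\boldsymbol{b},A\boldsymbol{b},\ldots,A^{k-1}\boldsymbol{b}\}$, and $H_k=Q^*AQ$, where the columns of $Q$ form an orthonormal basis of $\mathcal{K}_k(A,\boldsymbol{b})$ (if $\dim\mathcal{K}_k(A,\boldsymbol{b})<k$, then $H_k$ has size $\dim\mathcal{K}_k(A,\boldsymbol{b})$); thus $W(H_k)=\{\boldsymbol{x}^*A\boldsymbol{x}/\boldsymbol{x}^*\boldsymbol{x} : \boldsymbol{x}\in\mathcal{K}_k(A,\boldsymbol{b})\setminus\{0\}\}$. $\mathbb{S}^{n-1}$ is the complex unit sphere $\{\boldsymbol{x}\in\mathbb{C}^n:\|\boldsymbol{x}\|_2=1\}$, with uniform probability measure $\mathrm{Unif}(\mathbb{S}^{n-1})$. $d_H$ is the Hausdorff distance between subsets of $\mathbb{C}$, and $\mathrm{diam}$ is the diameter. The right-hand side of the first inequality is read as vacuous ($+\infty$) when $\min_{j}|\langle \boldsymbol{b},\boldsymbol{\varphi}^{(j)}\rangle|=0$,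 and an inequality of the form $x/\mathrm{diam}(W(A))\le y$ is read as $x\le y\,\mathrm{diam}(W(A))$.
   Formalization: The right-hand side of the first inequality is replaced by max(0, right-hand side): for m=1, n=2, A=diag(0,1), b=(1,1) it is 6 ln(e/3) < 0 while d_H = 0, so the literal inequality fails; it differs only for m=1, n=2 with diam(W(A)) > 0 and a negative logarithm. *)

(* Defs.v *)
From HB Require Import structures.
From mathcomp Require Import all_boot all_order all_algebra.
From mathcomp Require Import complex.
From mathcomp Require Import all_classical all_reals all_analysis.

Set Implicit Arguments.
Unset Strict Implicit.
Unset Printing Implicit Defensive.

Import Order.TTheory GRing.Theory Num.Theory.
Import numFieldNormedType.Exports.

Local Open Scope classical_set_scope.
Local Open Scope ring_scope.
Local Open Scope sesquilinear_scope.

(** [R[i]] carries an [R[i]]-valued norm; [cmod] is the [R]-valued modulus. *)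
Definition cmod (R : realType) (z : R[i]) : R := Normc.normc z.

Definition sqnorm (R : realType) (n : nat) (x : 'cV[R[i]]_n) : R :=
  \sum_(j < n) cmod (x j 0) ^+ 2.

Definition inner (R : realType) (n : nat) (x y : 'cV[R[i]]_n) : R[i] :=
  (y^t* *m x) 0 0.

Definition orthonormal_eigenbasis (R : realType) (n : nat) (A : 'M[R[i]]_n)
    (phi : 'I_n -> 'cV[R[i]]_n) : Prop :=
  (forall i j, inner (phi i) (phi j) = (i == j)%:R) /\
  (forall j, exists lambda : R[i], A *m phi j = lambda *: phi j).

(** An infimum over the finite index set ['I_n], hence a minimum as soon as
    [0 < n]. *)
Definition min_overlap (R : realType) (n : nat)
    (phi : 'I_n -> 'cV[R[i]]_n) (b : 'cV[R[i]]_n) : R :=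
  inf (range (fun j : 'I_n => cmod (inner b (phi j)))).

Definition numrange (R : realType) (k : nat) (M : 'M[R[i]]_k) : set R[i] :=
  [set z | exists2 x : 'cV[R[i]]_k,
     x != 0 & z = (x^t* *m M *m x) 0 0 / (x^t* *m x) 0 0].

(** MathComp subspaces are row spaces: the Krylov vectors are stored as rows
    (transposed, not conjugated). *)
Definition krylov (R : realType) (n : nat) (A : 'M[R[i]]_n)
    (b : 'cV[R[i]]_n) (k : nat) : 'M[R[i]]_(k, n) :=
  \matrix_(i < k) (A ^+ i *m b)^T.

(** The number [r] of columns is forced to be the dimension of the Krylov
    subspace. *)
Definition krylov_orthobasis (R : realType) (n : nat) (A : 'M[R[i]]_n)
    (b : 'cV[R[i]]_n) (k r : nat) (Q : 'M[R[i]]_(n, r)) : Prop :=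
  Q^t* *m Q = 1%:M /\ (Q^T == krylov A b k)%MS.

Lemma krylov_orthobasis_exists (R : realType) (n : nat) (A : 'M[R[i]]_n)
    (b : 'cV[R[i]]_n) (k : nat) :
  exists Q : 'M[R[i]]_(n, \rank (krylov A b k)), krylov_orthobasis A b k Q.
Proof.
set K := krylov A b k.
exists (schmidt (row_base K))^T; split; last first.
  rewrite trmxK; apply/eqmxP.
  by apply: (eqmx_trans (eqmx_schmidt_free (row_base_free K))); exact: eq_row_base.
have /unitarymxP H : schmidt (row_base K) \is unitarymx.
  by rewrite schmidt_unitarymx// rank_leq_col.
apply: trmx_inj; rewrite trmx_mul trmxK trmx1 -[RHS]H; congr (_ *m _).
by apply/matrixP => i j; rewrite !mxE.
Qed.

Definition compression (R : realType) (n r : nat) (Q : 'M[R[i]]_(n, r))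
    (A : 'M[R[i]]_n) : 'M[R[i]]_r := Q^t* *m A *m Q.

Definition diam (R : realType) (S : set R[i]) : \bar R :=
  ereal_sup [set (cmod (z - w))%:E | z in S & w in S].

Definition dist_to (R : realType) (z : R[i]) (S : set R[i]) : \bar R :=
  ereal_inf [set (cmod (z - w))%:E | w in S].

Definition hausdorff_dist (R : realType) (S T : set R[i]) : \bar R :=
  maxe (ereal_sup [set dist_to z T | z in S])
       (ereal_sup [set dist_to w S | w in T]).

(** Complex column vectors with the Borel sigma-algebra; the ascription is what
    lets the topology of [R[i]] as a [numFieldType] be found. *)
Definition borel_cV (R : realType) (n : nat) : measurableType _ :=
  g_sigma_algebraType (@open 'cV[(R[i] : numFieldType)]_n).

(** The uniform distribution on the complex unit sphere, as a law on the
    ambient space: the (unique) Borel probability measure concentrated on the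
    sphere that is invariant under the unitary group. *)
Definition unif_sphere (R : realType) (n : nat) (d : measure_display)
    (T : measurableType d) (P : probability T R)
    (b : {RV P >-> borel_cV R n}) : Prop :=
  distribution P b [set x : 'cV[R[i]]_n | sqnorm x = 1] = 1%E /\
  forall U : 'M[R[i]]_n, U \is unitarymx ->
  forall E : set (borel_cV R n), measurable E ->
    distribution P b [set x : 'cV[R[i]]_n | E (U *m x)] = distribution P b E.

(* Main.v *)
Require Import Defs.
From HB Require Import structures.
From mathcomp Require Import all_boot all_order all_algebra.
From mathcomp Require Import complex.
From mathcomp Require Import all_classical all_reals all_analysis.
From mathcomp Require Import measurable_realfun ring lra.
Import Order.TTheory GRing.Theory Num.Theory.
Import numFieldNormedType.Exports.
Local Open Scope classical_set_scope.
Local Open Scope ring_scope.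

(* Let lambda_j be the eigenvalues of A and v_j = |<b, phi_j>|^2.  A vector of
   the Krylov space is p(A) b with deg p <= 6m, and its Rayleigh quotient is the
   mean of the lambda_j with weights |p(lambda_j)|^2 v_j, so every numerical
   range below is described by scalars.

   Since W(H) is convex (Toeplitz-Hausdorff) and W(A) is the convex hull of the
   lambda_j, the Hausdorff distance is at most e as soon as, in each direction
   u, some point of W(H) is within e of the supporting line of W(A).  After
   scaling, the eigenvalues lie in the half disc Re z <= 0, |z| <= 1 with the
   extreme eigenvalue at 0.  There q(z) = 1 + z/2 + z^2/6 satisfies
   |q(z)|^2 <= 1 + Re z / 3, so p = q^(3m) gives |p(z)|^2 <= exp (m Re z), which
   suppresses every eigenvalue far from the supporting line.

   For the probability, unitary invariance under the reflections of the
   coordinate planes, to first order in the angle, yields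
   (n + k) E[(1 - |x_a|^2)^(k+1)] = (n - 1 + k) E[(1 - |x_a|^2)^k]
   on the sphere.  Markov's inequality with k close to 1/t then bounds
   P[|x_a|^2 < t] by e n t; a union bound over the n coordinates concludes, the
   constant 5/4 being larger than e^2/6.  The event is measurable because, by
   convexity again, it is a countable intersection of finite intersections of
   open sets, each a union over all polynomials p. *)

Set Implicit Arguments.
Unset Strict Implicit.
Unset Printing Implicit Defensive.
Local Open Scope sesquilinear_scope.
Local Open Scope complex_scope.
Local Notation Re := complex.Re.
Local Notation Im := complex.Im.

(** * Complex arithmetic *)

Section ComplexArith.
Variable R : realType.
Implicit Types z w : R[i].

(** The squared modulus, kept polynomial in the two real coordinates so that identities reduce to
    [ring]. *)
Definition nsq (z : R[i]) : R := Re z ^+ 2 + Im z ^+ 2.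

Lemma conjCc z : Num.conj z = conjc z. Proof. reflexivity. Qed.

Lemma ReM z w : Re (z * w) = Re z * Re w - Im z * Im w.
Proof. by case: z w => a b [c d]. Qed.

Lemma ImM z w : Im (z * w) = Re z * Im w + Im z * Re w.
Proof. by case: z w => a b [c d]. Qed.

Lemma ReD z w : Re (z + w) = Re z + Re w. Proof. exact: raddfD. Qed.
Lemma ImD z w : Im (z + w) = Im z + Im w. Proof. exact: raddfD. Qed.
Lemma ReN z : Re (- z) = - Re z. Proof. exact: raddfN. Qed.
Lemma ImN z : Im (- z) = - Im z. Proof. exact: raddfN. Qed.
Lemma ReJ z : Re (conjc z) = Re z. Proof. by case: z. Qed.
Lemma ImJ z : Im (conjc z) = - Im z. Proof. by case: z. Qed.

Definition ReImE := (ReM, ImM, ReD, ImD, ReN, ImN, ReJ, ImJ).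

Lemma eqC z w : Re z = Re w -> Im z = Im w -> z = w.
Proof. by case: z w => a b [c d] /= -> ->. Qed.

Lemma nsqM z w : nsq (z * w) = nsq z * nsq w.
Proof. by rewrite /nsq !ReImE; ring. Qed.

Lemma nsqX z k : nsq (z ^+ k) = nsq z ^+ k.
Proof.
elim: k => [|k IH]; last by rewrite !exprS nsqM IH.
by rewrite !expr0 /nsq /= expr1n expr0n addr0.
Qed.

Lemma nsq_ge0 z : 0 <= nsq z.
Proof. by rewrite addr_ge0 ?sqr_ge0. Qed.

Lemma cmodE z : cmod z = Num.sqrt (nsq z).
Proof. by case: z. Qed.

Lemma sqr_cmod z : cmod z ^+ 2 = nsq z.
Proof. by rewrite cmodE sqr_sqrtr // nsq_ge0. Qed.

Lemma cmod_ge0 z : 0 <= cmod z.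
Proof. by rewrite cmodE sqrtr_ge0. Qed.

Lemma nsq_eq0 z : (nsq z == 0) = (z == 0).
Proof.
by case: z => a b; rewrite paddr_eq0 ?sqr_ge0 // !sqrf_eq0 eq_complex.
Qed.

Lemma nsq_gt0 z : (0 < nsq z) = (z != 0).
Proof. by rewrite lt_def nsq_ge0 nsq_eq0 andbT. Qed.

Lemma nsqJ z : nsq (conjc z) = nsq z.
Proof. by rewrite /nsq ReJ ImJ sqrrN. Qed.

Lemma nsqN z : nsq (- z) = nsq z.
Proof. by rewrite /nsq ReN ImN !sqrrN. Qed.

Lemma nsqC (r : R) : nsq r%:C = r ^+ 2.
Proof. by rewrite /nsq /= expr0n addr0. Qed.

Lemma mulJc z : conjc z * z = (nsq z)%:C.
Proof. by apply: eqC; rewrite !ReImE /nsq /=; ring. Qed.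

Lemma cmodN z : cmod (- z) = cmod z.
Proof. by rewrite !cmodE nsqN. Qed.

Lemma cmod_lt z (e : R) : 0 <= e -> (cmod z < e) = (nsq z < e ^+ 2).
Proof. by move=> e0; rewrite -sqr_cmod ltr_pXn2r // nnegrE cmod_ge0. Qed.

Lemma cmod_le z (e : R) : 0 <= e -> (cmod z <= e) = (nsq z <= e ^+ 2).
Proof. by move=> e0; rewrite -sqr_cmod ler_pXn2r // nnegrE cmod_ge0. Qed.

Lemma cmodD z w : cmod (z + w) <= cmod z + cmod w.
Proof. exact: le_normcD. Qed.

Lemma cmodM z w : cmod (z * w) = cmod z * cmod w.
Proof. by rewrite !cmodE nsqM sqrtrM ?nsq_ge0. Qed.

Lemma cmodC (r : R) : 0 <= r -> cmod r%:C = r.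
Proof. by move=> r0; rewrite cmodE nsqC sqrtr_sqr ger0_norm. Qed.

Lemma cmod0 : cmod (0 : R[i]) = 0.
Proof. exact: cmodC (lexx 0). Qed.

Lemma cmod_sum (I : Type) (s : seq I) (P : pred I) (F : I -> R[i]) :
  cmod (\sum_(i <- s | P i) F i) <= \sum_(i <- s | P i) cmod (F i).
Proof.
elim/big_ind2: _ => [|a x b y ha hb|//]; first by rewrite cmod0.
by rewrite (le_trans (cmodD _ _)) // lerD.
Qed.

Lemma Re_sum (I : Type) (s : seq I) (P : pred I) (F : I -> R[i]) :
  Re (\sum_(i <- s | P i) F i) = \sum_(i <- s | P i) Re (F i).
Proof. by elim/big_rec2: _ => // i x y _ <-; rewrite ReD. Qed.

Lemma Im_sum (I : Type) (s : seq I) (P : pred I) (F : I -> R[i]) :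
  Im (\sum_(i <- s | P i) F i) = \sum_(i <- s | P i) Im (F i).
Proof. by elim/big_rec2: _ => // i x y _ <-; rewrite ImD. Qed.

Lemma ReCM (r : R) z : Re (r%:C * z) = r * Re z.
Proof. by rewrite ReM /= mul0r subr0. Qed.

Lemma ImCM (r : R) z : Im (r%:C * z) = r * Im z.
Proof. by rewrite ImM /= mul0r addr0. Qed.

End ComplexArith.

(** * Numerical ranges and Krylov spaces *)

Section NumericalRange.
Variable R : realType.

Definition sesq k (M : 'M[R[i]]_k) (x y : 'cV[R[i]]_k) : R[i] :=
  (x^t* *m M *m y) 0 0.

Lemma sqnorm_ge0 k (x : 'cV[R[i]]_k) : 0 <= sqnorm x.
Proof. by apply: sumr_ge0 => j _; rewrite exprn_ge0 // cmod_ge0. Qed.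

Lemma sqnorm_eq0 k (x : 'cV[R[i]]_k) : (sqnorm x == 0) = (x == 0).
Proof.
apply/eqP/eqP => [h|->]; last first.
  by rewrite /sqnorm big1 // => j _; rewrite mxE cmod0 expr0n.
apply/matrixP => i j; rewrite ord1 mxE; apply/eqP; rewrite -nsq_eq0 -sqr_cmod.
move/eqP: h; rewrite psumr_eq0 => [/allP/(_ i)|l _]; last exact/exprn_ge0/cmod_ge0.
by rewrite mem_index_enum => /(_ isT).
Qed.

Lemma dot_sqnorm k (x : 'cV[R[i]]_k) : (x^t* *m x) 0 0 = (sqnorm x)%:C.
Proof.
rewrite mxE /sqnorm rmorph_sum; apply: eq_bigr => j _.
by rewrite !mxE conjCc mulJc sqr_cmod.
Qed.

Lemma numrangeP k (M : 'M[R[i]]_k) z :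
  numrange M z <-> exists2 x, x != 0 & sesq M x x = z * (sqnorm x)%:C.
Proof.
have nz (x : 'cV[R[i]]_k) : x != 0 -> (sqnorm x)%:C != 0.
  by move=> x0; rewrite (inj_eq (@complexI _) _ 0) sqnorm_eq0.
split=> -[x x0].
  by rewrite dot_sqnorm => ->; exists x => //; rewrite divfK ?nz.
by exists x => //; rewrite dot_sqnorm -/(sesq M x x) q mulfK ?nz.
Qed.

Lemma sesqD k (M : 'M[R[i]]_k) (a b : R[i]) (x y : 'cV[R[i]]_k) :
  sesq M (a *: x + b *: y) (a *: x + b *: y) =
  (nsq a)%:C * sesq M x x + (nsq b)%:C * sesq M y y
  + (conjc a * b * sesq M x y + conjc b * a * sesq M y x).
Proof.
rewrite /sesq.
have -> : (a *: x + b *: y)^t* = conjc a *: x^t* + conjc b *: y^t*.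
  by apply/matrixP => i j; rewrite !mxE !conjCc rmorphD !rmorphM.
rewrite !(mulmxDl, mulmxDr) -!(scalemxAl, scalemxAr).
move: (_ *m x) (_ *m y) (_ *m x) (_ *m y) => xx xy yx yy.
by rewrite !mxE -!mulJc; ring.
Qed.

Lemma sesq1 k (x : 'cV[R[i]]_k) : sesq 1%:M x x = (sqnorm x)%:C.
Proof. by rewrite /sesq mulmx1 dot_sqnorm. Qed.

Lemma sesqZ k (M : 'M[R[i]]_k) (a : R[i]) (x : 'cV[R[i]]_k) :
  sesq M (a *: x) (a *: x) = (nsq a)%:C * sesq M x x.
Proof.
have := sesqD M a 0 x 0; rewrite !scale0r !addr0 => ->.
by rewrite conjc0 /nsq /= expr0n !addr0 !(mulr0, mul0r, addr0).
Qed.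

(* Toeplitz-Hausdorff.  After dividing by [z1 - z2], membership of the convex
   combination is a real quadratic equation in [p], [q], provided the phase of
   [a] makes the cross term real. *)
Lemma numrange_convex k (M : 'M[R[i]]_k) (z1 z2 : R[i]) (t : R) :
  numrange M z1 -> numrange M z2 -> 0 <= t <= 1 ->
  numrange M (t%:C * z1 + (1 - t)%:C * z2).
Proof.
move=> h1 h2 /andP[t0 t1].
have [z12|z12] := eqVneq z1 z2.
  by rewrite -z12 -mulrDl -rmorphD addrC subrK mul1r.
move/numrangeP: h1 => [x x0 hx]; move/numrangeP: h2 => [y y0 hy].
set z := (X in numrange _ X); set d := z1 - z2.
have d0 : d != 0 by rewrite subr_eq0.
(* This normalisation sends [z] to 0: a nonzero [u] has Rayleigh quotient [z] exactly when
   [g u u = 0]. *)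
pose g u v := (sesq M u v - z * sesq 1%:M u v) / d.
have gD a b : g (a *: x + b *: y) (a *: x + b *: y) =
    (nsq a)%:C * g x x + (nsq b)%:C * g y y
    + (conjc a * b * g x y + conjc b * a * g y x).
  rewrite /g !sesqD; clearbody z d.
  move: (sesq M x x) (sesq M x y) (sesq M y x) (sesq M y y) => xx xy yx yy.
  move: (sesq _ x x) (sesq _ x y) (sesq _ y x) (sesq _ y y) => xx' xy' yx' yy'.
  move: (nsq a)%:C (nsq b)%:C (conjc a) (conjc b) => na nb a' b'.
  by rewrite !mulrDl; field.
have gx : g x x = ((1 - t) * sqnorm x)%:C.
  rewrite /g sesq1 hx -mulrBl; apply: (mulIf d0); rewrite divfK //.
  by rewrite rmorphM /z /d rmorphB rmorph1 /=; ring.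
have gy : g y y = (- t * sqnorm y)%:C.
  rewrite /g sesq1 hy -mulrBl; apply: (mulIf d0); rewrite divfK //.
  by rewrite rmorphM /z /d rmorphN rmorphB rmorph1 /=; ring.
have [a a0 ha] : exists2 a : R[i], a != 0 &
    Im (conjc a * g x y + a * g y x) = 0.
  move: (g x y) (g y x) => [u1 u2] [v1 v2].
  have [e|e] := eqVneq ((u1 - v1) +i* (u2 + v2))%C 0.
    move/eqP: e; rewrite eq_complex /= => /andP[_ /eqP e].
    by exists 1; rewrite ?oner_neq0 // rmorph1 !mul1r.
  (* For a = a1 + i a2 the imaginary part is [a1 * (u2 + v2) - a2 * (u1 - v1)]. *)
  by exists ((u1 - v1) +i* (u2 + v2))%C; rewrite //=; ring.
pose beta := Re (conjc a * g x y + a * g y x).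
have [p [q [pq0 hpq]]] : exists p q : R, (p != 0) || (q != 0) /\
    nsq a * ((1 - t) * sqnorm x) * p ^+ 2 + beta * p * q - t * sqnorm y * q ^+ 2 = 0.
  set P := nsq a * _; have P0 : 0 <= P.
    by rewrite mulr_ge0 ?nsq_ge0 // mulr_ge0 ?sqnorm_ge0 ?subr_ge0.
  have [P00|Pn0] := eqVneq P 0.
    by exists 1, 0; rewrite oner_neq0 P00; split => //; ring.
  (* With [P > 0] and constant term [- Q <= 0], the discriminant is nonnegative and a real root
     exists at q = 1. *)
  set Q := t * _; have Q0 : 0 <= Q by rewrite mulr_ge0 ?sqnorm_ge0.
  have D0 : 0 <= beta ^+ 2 + 4 * P * Q.
    by rewrite addr_ge0 ?sqr_ge0 // mulr_ge0 // mulr_ge0.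
  exists ((- beta + Num.sqrt (beta ^+ 2 + 4 * P * Q)) / (2 * P)), 1.
  rewrite oner_neq0 orbT; split => //.
  have := sqr_sqrtr D0; move: (Num.sqrt _) => s hs.
  have -> : P * ((- beta + s) / (2 * P)) ^+ 2 + beta * ((- beta + s) / (2 * P)) * 1
     - Q * 1 ^+ 2 = (s ^+ 2 - beta ^+ 2 - 4 * P * Q) / (4 * P) by field.
  by rewrite hs (_ : _ - _ - _ = 0) ?mul0r //; ring.
apply/numrangeP; exists ((p%:C * a) *: x + q%:C *: y); last first.
  apply/eqP; rewrite -subr_eq0 -sesq1.
  suff : g ((p%:C * a) *: x + q%:C *: y) ((p%:C * a) *: x + q%:C *: y) = 0.
    by move/(congr1 ( *%R^~ d)); rewrite /g divfK // mul0r => ->.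
  rewrite gD gx gy nsqM !nsqC -!rmorphM -rmorphD.
  have -> : conjc (p%:C * a) * q%:C * g x y + conjc q%:C * (p%:C * a) * g y x
     = (p * q)%:C * (conjc a * g x y + a * g y x).
    have -> : conjc (p%:C * a) = p%:C * conjc a.
      by case: (a) => a1 a2; apply: eqC; rewrite !ReImE /=; ring.
    by rewrite conjc_real [(p * q)%:C]rmorphM; ring.
  move: @beta ha hpq; move: (_ + _ * g y x) => W /= ha hpq.
  apply: eqC; first by rewrite ReD ReCM /= -[RHS]hpq; ring.
  by rewrite ImD ImCM /= ha mulr0 addr0.
(* If the combination vanished, [y] would be a multiple of [x] and share its Rayleigh quotient,
   contrary to [z1 != z2]. *)
apply/negP => /eqP e.
have q0 : q != 0.
  apply/negP => /eqP q0; move: pq0 e; rewrite q0 eqxx orbF => p0 /eqP.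
  rewrite scale0r addr0 scaler_eq0 (negPf x0) orbF mulf_eq0 (negPf a0) orbF.
  by rewrite (inj_eq (@complexI _) _ 0) (negPf p0).
have qC0 : q%:C != 0 :> R[i] by rewrite (inj_eq (@complexI _) _ 0).
have ey : y = - (p%:C * a / q%:C) *: x.
  apply: (scalerI qC0); rewrite scalerA mulrN mulrC divfK // scaleNr.
  by apply/eqP; rewrite -addr_eq0 addrC e.
move: z12 hy; rewrite ey -sesq1 !sesqZ hx sesq1 => /negP z12 hy.
apply: z12; apply/eqP.
have s0 : (nsq (- (p%:C * a / q%:C)))%:C * (sqnorm x)%:C != 0 :> R[i].
  rewrite mulf_neq0 // (inj_eq (@complexI _) _ 0) ?sqnorm_eq0 // nsq_eq0.
  by apply: contraNneq y0 => c0; rewrite ey c0 scale0r.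
apply: (mulIf s0); rewrite [RHS]mulrC -[RHS]mulrA [in RHS]mulrC -[LHS]mulrCA hy.
by ring.
Qed.

End NumericalRange.

(** * Eigencoordinates and Krylov polynomials *)

Section Spectral.
Variables (R : realType) (n : nat) (A : 'M[R[i]]_n).
Variables (phi : 'I_n -> 'cV[R[i]]_n) (lam : 'I_n -> R[i]).
Hypothesis phi_on : forall i j, inner (phi i) (phi j) = (i == j)%:R.
Hypothesis lamE : forall j, A *m phi j = lam j *: phi j.

Definition eigmx : 'M[R[i]]_n := \matrix_(i, j) phi j i 0.

Definition coord (x : 'cV[R[i]]_n) : 'cV[R[i]]_n := eigmx^t* *m x.

Definition weight (b : 'cV[R[i]]_n) (j : 'I_n) : R := nsq (coord b j 0).

Lemma coordE x j : coord x j 0 = inner x (phi j).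
Proof. by rewrite /inner !mxE; apply: eq_bigr => i _; rewrite !mxE. Qed.

Lemma weight_ge0 b j : 0 <= weight b j. Proof. exact: nsq_ge0. Qed.

Lemma eigmx_adjK : eigmx^t* *m eigmx = 1%:M.
Proof.
apply/matrixP => i j; rewrite [RHS]mxE eq_sym -phi_on /inner !mxE.
by apply: eq_bigr => k _; rewrite !mxE.
Qed.

Lemma eigmxK : eigmx *m eigmx^t* = 1%:M.
Proof. exact: mulmx1C eigmx_adjK. Qed.

Lemma eigmx_unitary : eigmx^t* \is unitarymx.
Proof. by apply/unitarymxP; rewrite trmxCK eigmx_adjK. Qed.

Lemma coordK x : eigmx *m coord x = x.
Proof. by rewrite mulmxA eigmxK mul1mx. Qed.

Lemma dot_coord x y :
  (x^t* *m y) 0 0 = \sum_j conjc (coord x j 0) * coord y j 0.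
Proof.
have -> : x^t* *m y = (coord x)^t* *m coord y.
  by rewrite /coord trmx_mul map_mxM trmxCK mulmxA -(mulmxA _ eigmx) eigmxK mulmx1.
by rewrite mxE; apply: eq_bigr => j _; rewrite !mxE conjCc.
Qed.

Lemma sqnorm_weight x : sqnorm x = \sum_j weight x j.
Proof.
apply: (@complexI R); rewrite -dot_sqnorm dot_coord rmorph_sum.
by apply: eq_bigr => j _; rewrite mulJc.
Qed.

Lemma coordA x j : coord (A *m x) j 0 = lam j * coord x j 0.
Proof.
have eA : eigmx^t* *m A = diag_mx (\row_j lam j) *m eigmx^t*.
  have AE : A *m eigmx = eigmx *m diag_mx (\row_j lam j).
    apply/matrixP => i k; rewrite mul_mx_diag !mxE.
    have /matrixP/(_ i 0) := lamE k; rewrite !mxE [RHS]mulrC => <-.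
    by apply: eq_bigr => l _; rewrite !mxE.
  by rewrite -[LHS]mulmx1 -eigmxK mulmxA -(mulmxA _ A) AE mulmxA eigmx_adjK mul1mx.
by rewrite /coord mulmxA eA -mulmxA mul_diag_mx !mxE.
Qed.

Lemma coord_exprA x j i : coord (A ^+ i *m x) j 0 = lam j ^+ i * coord x j 0.
Proof.
elim: i => [|i IH]; first by rewrite !expr0 mul1r mul1mx.
by rewrite !exprS -mulmxA coordA IH mulrA.
Qed.

Lemma sesq_coord x : sesq A x x = \sum_j (weight x j)%:C * lam j.
Proof.
rewrite /sesq -mulmxA dot_coord; apply: eq_bigr => j _.
by rewrite coordA mulrCA mulJc mulrC.
Qed.

(** When all weights vanish, division by zero makes this 0; hence the side conditions
    [exists j, c j != 0] in later statements. *)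
Definition wavg (c : 'I_n -> R) : R[i] :=
  \sum_j (c j / \sum_k c k)%:C * lam j.

Definition krylov_weights (v : 'I_n -> R) (p : {poly R[i]}) (j : 'I_n) : R :=
  nsq p.[lam j] * v j.

Lemma numrange_wavg z : numrange A z <->
  exists2 x, x != 0 & z = wavg (weight x).
Proof.
have nz (x : 'cV[R[i]]_n) : x != 0 -> (sqnorm x)%:C != 0 :> R[i].
  by move=> x0; rewrite (inj_eq (@complexI _) _ 0) sqnorm_eq0.
have E x : x != 0 -> wavg (weight x) * (sqnorm x)%:C = sesq A x x.
  move=> x0; rewrite sesq_coord /wavg mulr_suml; apply: eq_bigr => j _.
  by rewrite -sqnorm_weight mulrAC -rmorphM divfK ?sqnorm_eq0.
split=> [/numrangeP[x x0 h]|[x x0 ->]].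
  by exists x => //; apply: (mulIf (nz x x0)); rewrite E.
by apply/numrangeP; exists x => //; rewrite E.
Qed.

Lemma numrange_eigenvalue i : numrange A (lam i).
Proof.
apply/numrangeP; exists (phi i).
  apply: contraTneq (oner_neq0 R[i]) => e.
  have := phi_on i i; rewrite eqxx e /inner mulmx0 mxE => h.
  exact/negPn/eqP/esym/h.
by rewrite /sesq -mulmxA lamE -scalemxAr mxE dot_sqnorm.
Qed.

(** A vector of the Krylov space is p(A) b, where [c] lists the coefficients of p, and p(A)
    multiplies the j-th eigencoordinate by p(lam j). *)
Lemma weight_poly (b : 'cV[R[i]]_n) k (c : 'rV[R[i]]_k) x :
  x^T = c *m krylov A b k ->
  weight x = krylov_weights (weight b) (\poly_(i < k) (if insub i is Some j then c 0 j else 0)).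
Proof.
move=> xE; apply/funext => j; rewrite /krylov_weights /weight -nsqM; congr nsq.
have -> : x = \sum_(i < k) c 0 i *: (A ^+ i *m b).
  apply: trmx_inj; rewrite xE; apply/matrixP => i l; rewrite ord1 !mxE summxE.
  by apply: eq_bigr => s _; rewrite !mxE.
rewrite horner_poly /coord mulmx_sumr summxE mulr_suml.
apply: eq_bigr => i _; rewrite valK -scalemxAr mxE -[in RHS]mulrA; congr (_ * _).
exact: coord_exprA.
Qed.

(** [Q] is an isometry onto the Krylov space, so the Rayleigh quotients of the compression are those
    of [A] at the nonzero vectors p(A) b with deg p < k. This removes [Q] from all later
    arguments. *)
Lemma numrange_compression b k r (Q : 'M[R[i]]_(n, r)) :
  krylov_orthobasis A b k Q -> forall z, numrange (compression Q A) z <->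
  exists2 p : {poly R[i]}, (size p <= k)%N &
    (exists j, krylov_weights (weight b) p j != 0) /\
    z = wavg (krylov_weights (weight b) p).
Proof.
move=> [QQ /eqmxP QK] z.
have QI y : sesq (compression Q A) y y = sesq A (Q *m y) (Q *m y).
  by rewrite /sesq /compression trmx_mul map_mxM !mulmxA.
have QN y : sqnorm (Q *m y) = sqnorm y.
  apply: (@complexI R); rewrite -!dot_sqnorm trmx_mul map_mxM.
  by rewrite -mulmxA (mulmxA _ Q) QQ mul1mx.
have nz x : (x != 0) <-> exists j, weight x j != 0.
  rewrite -sqnorm_eq0 sqnorm_weight; split=> [|[j wj]].
    rewrite psumr_neq0 => [/hasP[j _ /= wj]|j _]; last exact: weight_ge0.
    by exists j; rewrite gt_eqF.
  rewrite psumr_neq0 => [|i _]; last exact: weight_ge0.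
  by apply/hasP; exists j; rewrite ?mem_index_enum //= lt_def wj weight_ge0.
have numA x : x != 0 -> sesq A x x = z * (sqnorm x)%:C -> z = wavg (weight x).
  move=> x0 h; have nx : (sqnorm x)%:C != 0 :> R[i].
    by rewrite (inj_eq (@complexI _) _ 0) sqnorm_eq0.
  apply: (mulIf nx); rewrite -h sesq_coord /wavg mulr_suml; apply: eq_bigr => j _.
  by rewrite -sqnorm_weight mulrAC -rmorphM divfK ?sqnorm_eq0.
split=> [/numrangeP[y y0 h]|[p sp [pw ->]]].
  have x0 : Q *m y != 0 by rewrite -sqnorm_eq0 QN sqnorm_eq0.
  have /submxP[c cE] : ((Q *m y)^T <= krylov A b k)%MS.
    by rewrite trmx_mul -QK submxMl.
  have wE := weight_poly cE.
  exists (\poly_(i < k) (if insub i is Some j then c 0 j else 0)).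
    exact: size_poly.
  by rewrite -wE; split; [exact/nz|apply: numA => //; rewrite -QI h QN].
pose c : 'rV[R[i]]_k := \row_i p`_i.
pose x := (c *m krylov A b k)^T.
have wE : weight x = krylov_weights (weight b) p.
  rewrite (@weight_poly b k c) ?trmxK //; congr krylov_weights.
  apply/polyP => i; rewrite coef_poly; case: ltnP => ik.
    by rewrite insubT mxE.
  by rewrite nth_default // (leq_trans sp).
have /submxP[y yE] : (x^T <= Q^T)%MS by rewrite trmxK QK submxMl.
have xE : x = Q *m y^T by apply: trmx_inj; rewrite trmx_mul (trmxK y) yE.
have x0 : x != 0 by apply/nz; rewrite wE; exact: pw.
apply/numrangeP; exists y^T; first by rewrite -sqnorm_eq0 -QN -xE sqnorm_eq0.
rewrite QI -QN -xE -wE sesq_coord /wavg mulr_suml; apply: eq_bigr => j _.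
by rewrite -sqnorm_weight mulrAC -rmorphM divfK ?sqnorm_eq0.
Qed.

End Spectral.

(** * Convexity and the Hausdorff distance *)

Section Convexity.
Variable R : realType.
Implicit Types S W : set R[i].

Definition convexC S : Prop := forall z1 z2 (t : R),
  S z1 -> S z2 -> 0 <= t <= 1 -> S (t%:C * z1 + (1 - t)%:C * z2).

(** Stating the barycentre with the total mass as a factor lets the induction pass through a total
    mass of 0, where any [w] in [S] will do. *)
Lemma convex_sum S (I : Type) (s : seq I) (c : I -> R) (z : I -> R[i]) :
  convexC S -> S !=set0 -> (forall i, 0 <= c i) -> (forall i, S (z i)) ->
  exists2 w, S w & \sum_(i <- s) (c i)%:C * z i = (\sum_(i <- s) c i)%:C * w.
Proof.
move=> cS [w0 Sw0] c0 Sz; elim: s => [|i s [w Sw IH]].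
  by exists w0 => //; rewrite !big_nil mul0r.
rewrite !big_cons IH; set C := \sum_(j <- s) c j.
have C0 : 0 <= C by exact: sumr_ge0.
have [e|ne] := eqVneq (c i + C) 0.
  exists w => //; move/eqP: (e); rewrite paddr_eq0 // => /andP[/eqP-> /eqP->].
  by rewrite addr0 !mul0r addr0.
exists ((c i / (c i + C))%:C * z i + (1 - c i / (c i + C))%:C * w).
  apply: cS => //; rewrite divr_ge0 ?addr_ge0 //=.
  by rewrite ler_pdivrMr ?mul1r ?lerDl // lt_def ne addr_ge0.
rewrite mulrDr !mulrA -!rmorphM.
by congr (_%:C * _ + _%:C * _); field.
Qed.

(** Convexity of the open neighbourhood is what extends a distance bound from the eigenvalues to
    their whole hull. *)
Lemma convex_thicken S (e : R) : convexC S ->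
  convexC [set w | exists2 z, S z & cmod (w - z) < e].
Proof.
move=> cS w1 w2 t [z1 S1 h1] [z2 S2 h2] /andP[t0 t1].
exists (t%:C * z1 + (1 - t)%:C * z2); first by apply: cS => //; rewrite t0.
have -> : t%:C * w1 + (1 - t)%:C * w2 - (t%:C * z1 + (1 - t)%:C * z2) =
  t%:C * (w1 - z1) + (1 - t)%:C * (w2 - z2) by ring.
rewrite (le_lt_trans (cmodD _ _)) // !cmodM !cmodC ?subr_ge0 //.
move: (cmod _) (cmod _) h1 h2 => a b ha hb.
have [->|tn0] := eqVneq t 0; first by rewrite mul0r add0r subr0 mul1r.
have tp : 0 < t by rewrite lt_def tn0.
have : t * a < t * e by rewrite ltr_pM2l.
have : (1 - t) * b <= (1 - t) * e by rewrite ler_wpM2l ?subr_ge0 // ltW.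
move=> h1 h2; nra.
Qed.

Lemma wavg_mem S n (lam : 'I_n -> R[i]) (c : 'I_n -> R) :
  convexC S -> (forall i, S (lam i)) -> (forall j, 0 <= c j) ->
  (exists j, c j != 0) -> S (wavg lam c).
Proof.
move=> cS Sl c0 [j cj0].
have C0 : \sum_k c k != 0.
  by rewrite psumr_neq0 //; apply/hasP; exists j; rewrite ?mem_index_enum //= lt_def cj0 c0.
have [|w Sw E] := convex_sum (index_enum _) cS _ c0 Sl; first by exists (lam j).
suff -> : wavg lam c = w by [].
have C0' : (\sum_k c k)%:C != 0 :> R[i] by rewrite (inj_eq (@complexI _) _ 0).
apply: (mulfI C0'); rewrite -E /wavg mulr_sumr; apply: eq_bigr => k _.
by rewrite mulrA -rmorphM mulrCA mulfV ?mulr1.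
Qed.

(* An almost nearest point [z0] of [S] to [w] serves in place of a nearest one,
   so no compactness of [S] is needed: moving from [z0] towards the point [z]
   supplied for the direction [w - z0] would decrease the distance too much. *)
Lemma convex_approx S (B : R) (w : R[i]) (e eps : R) :
  convexC S -> (forall z, S z -> cmod z <= B) -> 0 <= e -> 0 < eps ->
  S !=set0 ->
  (forall u, u != 0 -> exists2 z, S z & Re (conjc u * (w - z)) <= e * cmod u) ->
  exists2 z, S z & cmod (w - z) < e + eps.
Proof.
move=> cS SB e0 ep0 [s0 Ss0] dir; apply: contrapT => hno.
have far z : S z -> (e + eps) ^+ 2 <= nsq (w - z).
  move=> Sz; rewrite leNgt; apply/negP => h; apply: hno; exists z => //.
  by rewrite cmod_lt // addr_ge0 // ltW.
pose D := [set nsq (w - z) | z in S].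
have Dinf : has_inf D.
  split; first by exists (nsq (w - s0)), s0.
  by exists 0 => _ [z Sz <-]; exact: nsq_ge0.
(* [K] bounds [nsq (z - z0)]. Since [t * K = eps ^+ 2], the gain [2 * t * eps ^+ 2] of a step of
   length [t] cancels two losses of at most [t ^+ 2 * K]: the slack in the choice of [z0] and the
   quadratic term. *)
pose K := (2 * B) ^+ 2 + eps ^+ 2.
have K0 : 0 < K by rewrite ltr_wpDl ?sqr_ge0 // exprn_gt0.
pose t := eps ^+ 2 / K.
have t0 : 0 < t by rewrite divr_gt0 // exprn_gt0.
have t1 : t <= 1 by rewrite ler_pdivrMr // mul1r lerDr sqr_ge0.
have eta0 : 0 < t ^+ 2 * K by rewrite mulr_gt0 // exprn_gt0.
have [_ [z0 Sz0 <-] hz0] := inf_adherent eta0 Dinf.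
have u0 : w - z0 != 0.
  by rewrite -nsq_gt0 (lt_le_trans _ (far _ Sz0)) // exprn_gt0 // ltr_wpDl.
have [z Sz hz] := dir _ u0.
have Sz' : S ((t%:C) * z + (1 - t)%:C * z0) by apply: cS => //; rewrite ltW.
have : inf D <= nsq (w - (t%:C * z + (1 - t)%:C * z0)).
  by apply: ge_inf; [case: Dinf | exists (t%:C * z + (1 - t)%:C * z0)].
have -> : nsq (w - (t%:C * z + (1 - t)%:C * z0)) = nsq (w - z0)
   - 2 * t * (nsq (w - z0) - Re (conjc (w - z0) * (w - z))) + t ^+ 2 * nsq (z - z0).
  case: w z z0 {hz0 u0 hz Sz' Sz Sz0 dir far hno D Dinf} => w1 w2 [z1 z2] [y1 y2].
  by rewrite /nsq /=; ring.
have zz : nsq (z - z0) <= K.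
  have : cmod (z - z0) <= 2 * B.
    rewrite (le_trans (cmodD _ _)) // cmodN mulr2n mulrDl mul1r lerD //; exact: SB.
  rewrite cmod_le.
    by move=> h; rewrite (le_trans h) // lerDl sqr_ge0.
  by rewrite mulr_ge0 // (le_trans (cmod_ge0 s0)) // SB.
have farm : eps ^+ 2 <= nsq (w - z0) - Re (conjc (w - z0) * (w - z)).
  have h1 : e + eps <= cmod (w - z0).
    by rewrite leNgt; apply/negP => h; apply: hno; exists z0.
  have := hz; rewrite -sqr_cmod; move: (cmod _) (Re _) h1 => c r h1 hr.
  have : eps * eps <= c * (c - e) by apply: ler_pM; lra.
  by rewrite expr2; lra.
have tK : t * K = eps ^+ 2 by rewrite divfK // gt_eqF.
move: hz0 zz farm; move: (nsq (w - z0)) (nsq (z - z0)) (Re _) => a b r h1 h2 h3.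
have h4 : t ^+ 2 * b <= t ^+ 2 * K by rewrite ler_pM2l // exprn_gt0.
have h5 : t * eps ^+ 2 <= t * (a - r) by rewrite ler_pM2l.
by move: h1 h4 h5; rewrite -tK expr2; lra.
Qed.

End Convexity.

(** * Hausdorff distance between a hull and a convex subset *)

Section Hausdorff.
Variables (R : realType) (n : nat) (lam : 'I_n -> R[i]) (S W : set R[i]).
Hypothesis S_convex : convexC S.
Hypothesis S_sub : S `<=` W.
Hypothesis W_lam : forall i, W (lam i).
Hypothesis W_hull : forall w, W w -> exists c : 'I_n -> R,
  [/\ forall j, 0 <= c j, exists j, c j != 0 & w = wavg lam c].

Lemma W_bounded z : W z -> cmod z <= \sum_j cmod (lam j).
Proof.
move=> /W_hull[c [c0 _ ->]]; rewrite (le_trans (cmod_sum _ _ _)) //.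
apply: ler_sum => j _; rewrite cmodM ler_piMl ?cmod_ge0 //.
have C0 : 0 <= \sum_k c k by exact: sumr_ge0.
rewrite cmodC ?divr_ge0 //.
have [->|ne] := eqVneq (\sum_k c k) 0; first by rewrite invr0 mulr0.
rewrite ler_pdivrMr ?mul1r ?lt_def ?ne // (bigD1 j) //= lerDl.
by apply: sumr_ge0.
Qed.

(** As [S] lies in [W], only the distances from points of [W] to [S] matter, and by [convex_thicken]
    it is enough to control them at the points [lam i]. The slack [eps] is there because the infimum
    need not be attained. *)
Lemma hausdorff_leP (e : R) : 0 <= e ->
  (hausdorff_dist S W <= e%:E)%E <->
  forall i eps, 0 < eps -> exists2 z, S z & cmod (lam i - z) < e + eps.
Proof.
move=> e0; split=> [h i eps ep0|h].
  apply: contrapT => hno.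
  have : (dist_to (lam i) S <= e%:E)%E.
    move: h; rewrite /hausdorff_dist ge_max => /andP[_]; apply: le_trans.
    by apply: ereal_sup_ubound; exists (lam i).
  apply/negP; rewrite -ltNge (@lt_le_trans _ _ (e + eps)%:E) //.
    by rewrite lte_fin ltrDl.
  apply: le_ereal_inf_tmp => _ [z Sz <-]; rewrite lee_fin leNgt.
  by apply/negP => hz; apply: hno; exists z.
have distle w T : (forall eps, 0 < eps -> exists2 z, T z & cmod (w - z) < e + eps) ->
    (dist_to w T <= e%:E)%E.
  move=> hT; apply/lee_addgt0Pr => eps ep0; have [z Tz hz] := hT _ ep0.
  apply: (@le_trans _ _ (cmod (w - z))%:E).
    by apply: ereal_inf_lbound; exists z.
  by rewrite -EFinD lee_fin ltW.
rewrite /hausdorff_dist ge_max; apply/andP; split.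
  apply: ge_ereal_sup => _ [z Sz <-]; apply: distle => eps ep0.
  by exists z; [exact: S_sub|rewrite subrr cmod0 ltr_wpDl].
apply: ge_ereal_sup => _ [w Ww <-]; apply: distle => eps ep0.
have [c [c0 cn0 ->]] := W_hull Ww.
apply: (@wavg_mem _ [set w | exists2 z, S z & cmod (w - z) < e + eps]) => // [|i].
  exact: convex_thicken.
exact: h.
Qed.

(** Combines [hausdorff_leP] with [convex_approx], applied at each eigenvalue: a point of [S] at
    most [e] short of the supporting line in every direction is enough. *)
Lemma hausdorff_le_dir (e : R) : 0 <= e -> S !=set0 ->
  (forall u, u != 0 ->
     exists2 z, S z & forall i, Re (conjc u * (lam i - z)) <= e * cmod u) ->
  (hausdorff_dist S W <= e%:E)%E.
Proof.
move=> e0 S0 dir; apply/hausdorff_leP => // i eps ep0.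
apply: (@convex_approx _ _ (\sum_j cmod (lam j))) => // [z Sz|u u0].
  exact/W_bounded/S_sub.
by have [z Sz h] := dir u u0; exists z.
Qed.

End Hausdorff.

(** * The filter polynomial and the deterministic bound *)

Section Filter.
Variable R : realType.

(** With x = Re z and r = |z|^2 the left side is 1 + x + 2 x^2 / 3 + r (r / 36 - 1 / 12) + r x / 6.
    The bound x^2 <= - x turns the first three terms into at most 1 + x / 3, and the other two are
    nonpositive. *)
Lemma nsq_filter (z : R[i]) : Re z <= 0 -> nsq z <= 1 ->
  nsq (1 + z / 2 + z ^+ 2 / 6) <= 1 + Re z / 3.
Proof.
move=> x0 z1.
have -> : 1 + z / 2 + z ^+ 2 / 6 =
    1 + (2^-1 : R)%:C * z + (6^-1 : R)%:C * (z * z).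
  by rewrite !fmorphV !rmorph_nat; field.
move: z x0 z1 => [x y]; rewrite /nsq /= => x0 z1.
set r := x ^+ 2 + y ^+ 2 in z1.
have r0 : 0 <= r by rewrite addr_ge0 ?sqr_ge0.
have -> : (1 + (2^-1 * x - 0 * y) + (6^-1 * (x * x - y * y) - 0 * (x * y + y * x))) ^+ 2
   + (0 + (2^-1 * y + 0 * x) + (6^-1 * (x * y + y * x) + 0 * (x * x - y * y))) ^+ 2
   = 1 + x + (2 / 3) * x ^+ 2 + r * (r / 36 - 1 / 12) + r * x / 6.
  by rewrite /r; field.
have y0 : 0 <= y ^+ 2 by exact: sqr_ge0.
have x1 : x * x <= - x.
  have : x ^+ 2 <= 1 by move: z1; rewrite /r; lra.
  move=> h; have h' : - 1 <= x by nra.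
  by nra.
have h1 : r * (r / 36 - 1 / 12) <= 0 by rewrite mulr_ge0_le0 //; lra.
have h2 : r * x <= 0 by rewrite mulr_ge0_le0.
by rewrite expr2; lra.
Qed.

(* Terms with [X j <= d] only help; the others carry weight at most
   [v j * expR (- m d)], which the term [i0] with [X i0 = 0] compensates. *)
Lemma weighted_mean_le n (v g X : 'I_n -> R) (i0 : 'I_n) (m d : R) :
  0 <= m -> 0 <= d -> (forall j, 0 <= v j) -> (forall j, 0 <= X j <= 1) -> X i0 = 0 ->
  (forall j, 0 <= g j <= v j * expR (- (m * X j))) -> g i0 = v i0 ->
  expR (- (m * d)) * \sum_j v j <= d * v i0 ->
  \sum_j g j * X j <= d * \sum_j g j.
Proof.
move=> m0 d0 v0 X01 Xi0 gb gi0 hd; rewrite -subr_le0 mulr_sumr -sumrB.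
have term j : g j * X j - d * g j <= expR (- (m * d)) * v j.
  have /andP[x0 x1] := X01 j; have /andP[g0 g1] := gb j.
  have [Xd|dX] := leP (X j) d.
    apply: (@le_trans _ _ 0); last by rewrite mulr_ge0 ?expR_ge0.
    by rewrite mulrC -mulrBl mulr_le0_ge0 // subr_le0.
  apply: (@le_trans _ _ (g j)).
    by rewrite mulrC -mulrBl ler_piMl // lerBlDr; lra.
  rewrite (le_trans g1) // mulrC ler_wpM2r // ler_expR lerN2 ler_wpM2l //.
  exact: ltW.
rewrite (bigD1 i0) //= Xi0 gi0 mulr0 sub0r addrC subr_le0 (le_trans _ hd) //.
rewrite mulr_sumr [leRHS](bigD1 i0) //= -[leLHS]add0r lerD //.
  by rewrite mulr_ge0 ?expR_ge0.
by apply: ler_sum => j _.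
Qed.

Variables (n : nat) (lam : 'I_n -> R[i]) (v : 'I_n -> R).
Hypothesis v_gt0 : forall j, 0 < v j.

Local Notation kw := (krylov_weights lam v).

Lemma krylov_weights_ge0 p j : 0 <= kw p j.
Proof. by rewrite mulr_ge0 ?nsq_ge0 // ltW. Qed.

Lemma krylov_weights_eq0 p j : (kw p j == 0) = (p.[lam j] == 0).
Proof. by rewrite mulf_eq0 nsq_eq0 (gt_eqF (v_gt0 j)) orbF. Qed.

Lemma sum_weights_gt0 p i0 : p.[lam i0] != 0 -> 0 < \sum_j kw p j.
Proof.
move=> p0; rewrite lt_def sumr_ge0 ?andbT => [|j _]; last exact: krylov_weights_ge0.
rewrite psumr_neq0 => [|j _]; last exact: krylov_weights_ge0.
apply/hasP; exists i0; rewrite ?mem_index_enum //= lt_def.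
by rewrite krylov_weights_eq0 p0 krylov_weights_ge0.
Qed.

(** The polynomial [p] vanishes at every eigenvalue other than [lam i], so all the weight falls on
    [lam i]. Its degree counts the indices j with [lam j != lam i], repetitions included. *)
Lemma krylov_exact k i : (#|[pred j | lam j != lam i]| < k)%N ->
  exists2 p : {poly R[i]}, (size p <= k)%N &
    (exists j, kw p j != 0) /\ lam i = wavg lam (kw p).
Proof.
move=> hk; pose r := [seq j <- enum 'I_n | lam j != lam i].
pose p := \prod_(j <- r) ('X - (lam j)%:P).
have pi0 : p.[lam i] != 0.
  rewrite /p horner_prod prodf_seq_neq0; apply/allP => j.
  by rewrite mem_filter => /andP[h _]; rewrite hornerXsubC subr_eq0 eq_sym.
have pj0 j : lam j != lam i -> p.[lam j] = 0.
  move=> h; apply/rootP; rewrite /p -(big_map lam predT (fun z => 'X - z%:P)).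
  by rewrite root_prod_XsubC; apply: map_f; rewrite mem_filter h mem_enum.
exists p.
  by rewrite size_prod_XsubC -sum1_size /r big_filter big_enum_cond sum1_card.
split; first by exists i; rewrite krylov_weights_eq0.
have S0 := sum_weights_gt0 pi0.
have -> : lam i = (\sum_j kw p j / \sum_k kw p k)%:C * lam i.
  by rewrite -mulr_suml mulfV ?gt_eqF // mul1r.
rewrite /wavg rmorph_sum mulr_suml; apply: eq_bigr => j _.
have [->//|h] := eqVneq (lam j) (lam i).
by rewrite /krylov_weights pj0 // /nsq /= expr0n addr0 !mul0r.
Qed.

(** The filter for one direction: [z] maps the extreme eigenvalue [lam i0] to 0 and the spectrum
    into the left half of the unit disc, and [q ^+ (3 * m)] has degree at most [6 * m]. The
    hypothesis tying [d] to the weights is the tail condition of [weighted_mean_le]; [i1] is the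
    starting index for the maximum. *)
Lemma krylov_direction (m : nat) (D d : R) (u : R[i]) (i1 : 'I_n) :
  0 < D -> (forall i j, cmod (lam i - lam j) <= D) -> 0 <= d ->
  (forall i, expR (- (m%:R * d)) * \sum_j v j <= d * v i) -> u != 0 ->
  exists2 p : {poly R[i]}, (size p <= 6 * m + 1)%N & (exists j, kw p j != 0) /\
    forall i, Re (conjc u * (lam i - wavg lam (kw p))) <= d * D * cmod u.
Proof.
move=> D0 hD d0 hd u0.
have [i0 hi0] : exists i0, forall i, Re (conjc u * lam i) <= Re (conjc u * lam i0).
  pose i0 := [arg max_(i > i1) Re (conjc u * lam i)]%O.
  by exists i0 => i; rewrite /i0; case: arg_maxP => // i2 _; apply.
have cu0 : 0 < cmod u by rewrite cmodE sqrtr_gt0 nsq_gt0.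
pose s := (D * cmod u)^-1%:C * conjc u.
pose z j := s * (lam j - lam i0).
have zRe j : Re (z j) <= 0.
  rewrite /z -mulrA ReCM mulrBr ReD ReN mulr_ge0_le0 //.
    by rewrite invr_ge0 mulr_ge0 // ltW.
  by rewrite subr_le0.
have zn j : nsq (z j) <= 1.
  rewrite -sqr_cmod -[leRHS](expr1n _ 2) ler_pXn2r ?nnegrE ?cmod_ge0 //.
  rewrite /z /s !cmodM [cmod (conjc u)]cmodE nsqJ -cmodE cmodC; last first.
    by rewrite invr_ge0 mulr_ge0 // ltW.
  rewrite invfM -(mulrA D^-1) mulVf ?gt_eqF // mulr1 mulrC ler_pdivrMr // mul1r.
  exact: hD.
pose y := s *: ('X - (lam i0)%:P).
pose q := 1 + 2^-1 *: y + 6^-1 *: (y * y).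
pose p := q ^+ (3 * m).
have pE j : p.[lam j] = (1 + z j / 2 + z j ^+ 2 / 6) ^+ (3 * m).
  have yE : y.[lam j] = z j by rewrite /y hornerZ hornerXsubC.
  rewrite /p horner_exp /q; move: (y) yE => y' yE.
  rewrite !(hornerD, hornerZ, hornerM) hornerC yE.
  by move: (z j) => w; congr (_ ^+ _); field.
have sy : (size y <= 2)%N.
  by rewrite (leq_trans (size_scale_leq _ _)) // size_XsubC.
have sq : (size q <= 3)%N.
  rewrite (leq_trans (size_polyD _ _)) // geq_max; apply/andP; split.
    rewrite (leq_trans (size_polyD _ _)) // geq_max size_poly1 /=.
    by rewrite (leq_trans (size_scale_leq _ _)) // (leq_trans sy).
  rewrite (leq_trans (size_scale_leq _ _)) // (leq_trans (size_polyMleq _ _)) //.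
  by rewrite -[3%N]/(4.-1)%N -!subn1 leq_sub2r // (leq_add sy sy).
have sp : (size p <= 6 * m + 1)%N.
  rewrite (leq_trans (size_poly_exp_leq _ _)) // addn1 ltnS.
  rewrite (_ : (6 * m = 2 * (3 * m))%N); last by rewrite mulnA.
  by rewrite leq_mul2r -subn1 leq_subLR sq orbT.
have zi0 : z i0 = 0 by rewrite /z subrr mulr0.
have pi0 : p.[lam i0] = 1.
  by rewrite pE zi0 mul0r expr0n mul0r !addr0 expr1n.
have pi0n : p.[lam i0] != 0 by rewrite pi0 oner_neq0.
have G0 := sum_weights_gt0 pi0n.
exists p => //; split; first by exists i0; rewrite krylov_weights_eq0.
have key : \sum_j kw p j * - Re (z j) <= d * \sum_j kw p j.
  apply: (@weighted_mean_le _ v _ _ i0 m%:R) => //.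
  - by move=> j; exact: ltW.
  - move=> j; rewrite oppr_ge0 zRe /=.
    have : Re (z j) ^+ 2 <= 1.
      by rewrite (le_trans _ (zn j)) // lerDl sqr_ge0.
    by move: (Re (z j)) => x h; nra.
  - by rewrite zi0 oppr0.
  - move=> j; rewrite krylov_weights_ge0 /krylov_weights mulrC ler_wpM2l ?(ltW (v_gt0 _)) //.
    rewrite pE nsqX.
    apply: (@le_trans _ _ ((1 + Re (z j) / 3) ^+ (3 * m))).
      rewrite lerXn2r ?nnegrE ?nsq_ge0 ?nsq_filter //.
      by rewrite (le_trans (nsq_ge0 _) (nsq_filter _ _)).
    apply: (@le_trans _ _ (expR (Re (z j) / 3) ^+ (3 * m))).
      rewrite lerXn2r ?nnegrE ?expR_ge0 ?expR_ge1Dx //.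
      by rewrite (le_trans (nsq_ge0 _) (nsq_filter _ _)).
    by rewrite -expRM_natl ler_expR natrM; lra.
  - by rewrite /krylov_weights pi0 /nsq /= expr0n addr0 expr1n mul1r.
(* Since [lam i0] is extreme in direction [u], its defect dominates that of every [lam i]. *)
move=> i; apply: (@le_trans _ _ (Re (conjc u * (lam i0 - wavg lam (kw p))))).
  by rewrite !mulrBr !ReD lerD2r.
have cE : conjc u = (D * cmod u)%:C * s.
  by rewrite /s mulrA -rmorphM mulfV ?mul1r // mulf_neq0 ?gt_eqF.
(* The defect is [D * cmod u] times the weighted mean of the [- z j], to whose real part [key]
   applies. *)
have -> : conjc u * (lam i0 - wavg lam (kw p)) =
   (D * cmod u / \sum_j kw p j)%:C * \sum_j (kw p j)%:C * - z j.
  have {1}-> : lam i0 = \sum_j (kw p j / \sum_k kw p k)%:C * lam i0.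
    by rewrite -mulr_suml -rmorph_sum -mulr_suml mulfV ?gt_eqF // mul1r.
  rewrite /wavg -sumrB cE -mulrA [(D * cmod u / _)%:C]rmorphM -[RHS]mulrA.
  congr (_ * _).
  rewrite !mulr_sumr; apply: eq_bigr => j _.
  by rewrite -mulrBr /z [(kw p j / _)%:C]rmorphM; ring.
rewrite ReCM Re_sum.
have -> : \sum_j Re ((kw p j)%:C * - z j) = \sum_j kw p j * - Re (z j).
  by apply: eq_bigr => j _; rewrite ReCM ReN.
rewrite mulrAC ler_pdivrMr //.
have := key; move: (\sum_j kw p j * - Re (z j)) => a.
move: (\sum_j kw p j) => G; move: (cmod u) cu0 => c c0 h.
have Dc : 0 < D * c by rewrite mulr_gt0.
rewrite (_ : d * D * c * G = D * c * (d * G)); last by ring.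
by rewrite ler_pM2l.
Qed.

End Filter.

Section ConstantBounds.
Variable R : realType.

(** The sixth power of [1 + 1 / 6 <= expR (1 / 6)]; indeed (7 / 6)^6 > 2.52. *)
Lemma expR1_ge52 : 5 / 2 <= expR 1 :> R.
Proof.
have -> : 1 = 6%:R * (6^-1) :> R by field.
rewrite expRM_natl (le_trans _ (lerXn2r _ _ _ (expR_ge1Dx _))) ?nnegrE ?expR_ge0 //; lra.
Qed.

(** Equivalent to 2 <= e^(4 / 5), which follows from (1 + 1 / 5)^4 > 2.07. *)
Lemma ln_e2_ge : 1 / 5 <= ln (expR 1 / 2) :> R.
Proof.
rewrite -[leLHS]expRK ler_ln ?posrE ?expR_gt0 ?divr_gt0 ?expR_gt0 //.
rewrite ler_pdivlMr // -ler_pdivlMl ?expR_gt0 // -expRN -expRD.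
have -> : - (1 / 5) + 1 = 4%:R * 5^-1 :> R by field.
rewrite expRM_natl (le_trans _ (lerXn2r _ _ _ (expR_ge1Dx _))) ?nnegrE ?expR_ge0 //; lra.
Qed.

End ConstantBounds.

(** * The deterministic inequality *)

Section Deterministic.
Variables (R : realType) (n : nat) (A : 'M[R[i]]_n).
Variables (phi : 'I_n -> 'cV[R[i]]_n) (lam : 'I_n -> R[i]).
Hypothesis n_gt0 : (0 < n)%N.
Hypothesis phi_on : forall i j, inner (phi i) (phi j) = (i == j)%:R.
Hypothesis lamE : forall j, A *m phi j = lam j *: phi j.

Lemma numrange_hull w : numrange A w -> exists c : 'I_n -> R,
  [/\ forall j, 0 <= c j, exists j, c j != 0 & w = wavg lam c].
Proof.
move=> /(numrange_wavg phi_on lamE)[x x0 ->]; exists (weight phi x); split => //.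
  by move=> j; exact: weight_ge0.
move: x0; rewrite -sqnorm_eq0 (sqnorm_weight phi_on) psumr_neq0 => [/hasP[j _ /= h]|j _].
  by exists j; rewrite gt_eqF.
exact: weight_ge0.
Qed.

Lemma numrange_compression_sub b k r (Q : 'M[R[i]]_(n, r)) :
  krylov_orthobasis A b k Q -> numrange (compression Q A) `<=` numrange A.
Proof.
move=> hQ z /(numrange_compression phi_on lamE hQ)[p _ [pw ->]].
apply: wavg_mem => //; first by move=> z1 z2 t h1 h2 ht; exact: numrange_convex.
- by move=> i; exact: (numrange_eigenvalue phi_on lamE).
- by move=> j; rewrite mulr_ge0 ?nsq_ge0.
Qed.

Lemma hausdorff_compression_leP b k r (Q : 'M[R[i]]_(n, r)) (e : R) : 0 <= e ->
  krylov_orthobasis A b k Q ->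
  (hausdorff_dist (numrange (compression Q A)) (numrange A) <= e%:E)%E <->
  forall i eps, 0 < eps ->
    exists2 z, numrange (compression Q A) z & cmod (lam i - z) < e + eps.
Proof.
move=> e0 hQ; apply: hausdorff_leP => //.
- by move=> z1 z2 t h1 h2 ht; exact: numrange_convex.
- exact: numrange_compression_sub hQ.
- by move=> i; exact: (numrange_eigenvalue phi_on lamE).
- exact: numrange_hull.
Qed.

Lemma diam_ge (S : set R[i]) z w : S z -> S w -> ((cmod (z - w))%:E <= diam S)%E.
Proof. by move=> Sz Sw; apply: ereal_sup_ubound; exists z => //; exists w. Qed.

(** Here [d] is the error relative to the diameter and [mu] a lower bound for the weights. The
    scaling uses the largest gap [P ij] between eigenvalues, which is at most the diameter of
    [W(A)]. *)
Lemma hausdorff_krylov_le b m r (Q : 'M[R[i]]_(n, r)) (d mu : R) :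
  krylov_orthobasis A b (6 * m + 1)%N Q ->
  0 < mu -> (forall j, mu <= weight phi b j) -> 0 <= d ->
  expR (- (m%:R * d)) * sqnorm b <= d * mu ->
  (hausdorff_dist (numrange (compression Q A)) (numrange A)
    <= d%:E * diam (numrange A))%E.
Proof.
move=> hQ mu0 hmu d0 hd.
have v0 j : 0 < weight phi b j by rewrite (lt_le_trans mu0).
pose P (ij : 'I_n * 'I_n) := cmod (lam ij.1 - lam ij.2).
pose i1 := Ordinal n_gt0.
have [ij hij] : exists ij, forall ij', P ij' <= P ij.
  exists [arg max_(ij > (i1, i1)) P ij]%O => ij'.
  by case: arg_maxP => // ij _; apply.
have PD : ((P ij)%:E <= diam (numrange A))%E.
  by apply: diam_ge; exact: (numrange_eigenvalue phi_on lamE).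
have hP i j : cmod (lam i - lam j) <= P ij by exact: (hij (i, j)).
apply: (@le_trans _ _ (d * P ij)%:E); last first.
  by rewrite EFinM lee_wpmul2l // lee_fin.
(* When all eigenvalues coincide there is no scale to divide by, and [krylov_exact] applies with no
   other eigenvalue to kill. *)
have [P0|P0] := eqVneq (P ij) 0.
  rewrite P0 mulr0; apply/(hausdorff_compression_leP _ hQ) => // i eps ep0.
  exists (lam i); last by rewrite subrr cmod0 add0r.
  apply/(numrange_compression phi_on lamE hQ).
  apply: krylov_exact => //; rewrite eq_card0 ?addn1 // => j.
  rewrite !inE; apply/negbTE; rewrite negbK -subr_eq0 -nsq_eq0 -sqr_cmod.
  by rewrite sqrf_eq0 eq_le cmod_ge0 -P0 hP.
have P1 : 0 < P ij by rewrite lt_def P0 cmod_ge0.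
have hd' i : expR (- (m%:R * d)) * \sum_j weight phi b j <= d * weight phi b i.
  by rewrite -(sqnorm_weight phi_on) (le_trans hd) // ler_wpM2l.
have dir u : u != 0 -> exists2 z, numrange (compression Q A) z &
    forall i, Re (conjc u * (lam i - z)) <= d * P ij * cmod u.
  move=> u0; have [p sp [pw h]] := krylov_direction v0 i1 P1 hP d0 hd' u0.
  exists (wavg lam (krylov_weights lam (weight phi b) p)) => //.
  by apply/(numrange_compression phi_on lamE hQ); exists p.
apply: (@hausdorff_le_dir _ n lam) => //.
- by move=> z1 z2 t h1 h2 ht; exact: numrange_convex.
- exact: numrange_compression_sub hQ.
- by move=> i; exact: (numrange_eigenvalue phi_on lamE).
- exact: numrange_hull.
- by rewrite mulr_ge0 // ltW.
- by have [z Sz _] := dir 1 (oner_neq0 _); exists z.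
Qed.

(** Treats [n <= 2], where the logarithm of the bound can be negative: the degree [6 * m] is then
    large enough to isolate each eigenvalue exactly. *)
Lemma hausdorff_krylov_small b m r (Q : 'M[R[i]]_(n, r)) : (0 < m)%N ->
  krylov_orthobasis A b (6 * m + 1)%N Q ->
  (forall j, 0 < weight phi b j) -> (n <= 2)%N ->
  (hausdorff_dist (numrange (compression Q A)) (numrange A) <= 0)%E.
Proof.
move=> m0 hQ v0 n2; apply/(hausdorff_compression_leP _ hQ) => // i eps ep0.
exists (lam i); last by rewrite subrr cmod0 add0r.
apply/(numrange_compression phi_on lamE hQ).
apply: krylov_exact => //; rewrite addn1 ltnS (leq_trans (max_card _)) //.
by rewrite card_ord (leq_trans n2) // (@leq_trans 6) // leq_pmulr.
Qed.

Lemma min_overlap_le b j : min_overlap phi b ^+ 2 <= weight phi b j.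
Proof.
rewrite /weight (coordE phi) -sqr_cmod ler_pXn2r ?nnegrE ?cmod_ge0 //.
  apply: ge_inf; last by exists j.
  by exists 0 => _ [i _ <-]; exact: cmod_ge0.
apply: lb_le_inf; first by exists (cmod (inner b (phi j))), j.
by move=> _ [i _ <-]; exact: cmod_ge0.
Qed.

Lemma min_overlap_ge b (t : R) : (forall j, t <= cmod (inner b (phi j))) ->
  t <= min_overlap phi b.
Proof.
move=> h; apply: lb_le_inf; last by move=> _ [i _ <-].
by exists (cmod (inner b (phi (Ordinal n_gt0)))), (Ordinal n_gt0).
Qed.

(** For [n] at least 3 take d = 6 L / m, where L is the logarithm. Then exp(- m d) = exp(- 5 L)
    exp(- L); the factor exp(- L) cancels [sqnorm b] against [mu], and what remains is exp(- 5 L) <=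
    e L, true once L >= 1 / 5. *)
Lemma min_overlap_bound b m r (Q : 'M[R[i]]_(n, r)) : (0 < m)%N ->
  min_overlap phi b != 0 -> krylov_orthobasis A b (6 * m + 1)%N Q ->
  (hausdorff_dist (numrange (compression Q A)) (numrange A)
   <= maxe 0 ((6 / m%:R * ln (expR 1 * m%:R * sqnorm b
                              / (6 * min_overlap phi b ^+ 2)))%:E
              * diam (numrange A)))%E.
Proof.
move=> m0 mu0 hQ; set mu := min_overlap phi b ^+ 2.
have mu1 : 0 < mu by rewrite lt_def sqrf_eq0 mu0 sqr_ge0.
have mur : (0 : R) < m%:R by rewrite ltr0n.
have m1 : (1 : R) <= m%:R by rewrite ler1n.
have hmu j : mu <= weight phi b j by exact: min_overlap_le.
clearbody mu.
rewrite le_max; apply/orP; have [n2|n3] := leqP n 2.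
  left; apply: hausdorff_krylov_small hQ _ n2 => // j.
  exact: lt_le_trans (hmu j).
right; set L := ln _.
(* Three weights of at least [mu] make the argument of the logarithm at least e / 2, whence L >= 1 /
   5 by [ln_e2_ge]. *)
have V3 : 3 * mu <= sqnorm b.
  rewrite (sqnorm_weight phi_on); apply: (@le_trans _ _ (\sum_(j < n) mu)).
    by rewrite sumr_const card_ord -[leRHS]mulr_natl ler_pM2r // ler_nat.
  by apply: ler_sum => j _.
have V0 : 0 < sqnorm b by rewrite (lt_le_trans _ V3) // mulr_gt0.
have e0 := expR_gt0 (1 : R).
have arg0 : 0 < expR 1 * m%:R * sqnorm b / (6 * mu).
  by apply: divr_gt0; do !apply: mulr_gt0.
have L5 : 1 / 5 <= L.
  rewrite (le_trans (ln_e2_ge R)) // ler_ln ?posrE ?arg0 ?(divr_gt0 e0) //.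
  rewrite ler_pdivlMr ?mulr_gt0 // -!mulrA ler_pM2l //.
  have : 1 * (3 * mu) <= m%:R * sqnorm b by rewrite ler_pM // mulr_ge0 // ltW.
  by lra.
have EL : expR L = expR 1 * m%:R * sqnorm b / (6 * mu) by rewrite /L lnK ?posrE.
clearbody L.
have L0 : 0 < L by lra.
apply: (hausdorff_krylov_le hQ mu1 hmu); first by rewrite mulr_ge0 ?divr_ge0 ?ltW.
have -> : m%:R * (6 / m%:R * L) = 5 * L + L by field; rewrite gt_eqF.
rewrite opprD expRD mulrAC -mulrA expRN expRN.
rewrite EL invf_div.
(* Both sides are compared with 1 / 2: [expR (5 * L) >= 1 + 5 * L >= 2], and e L >= (5 / 2) (1 /
   5). *)
have E5 : (expR (5 * L))^-1 <= expR 1 * L.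
  apply: (@le_trans _ _ 2^-1).
    rewrite lef_pV2 ?posrE ?expR_gt0 //.
    by rewrite (le_trans _ (expR_ge1Dx _)) //; lra.
  have : 5 / 2 * (1 / 5) <= expR 1 * L by apply: ler_pM => //; rewrite ?expR1_ge52 //; lra.
  by lra.
rewrite (_ : sqnorm b * _ = (6 / m%:R * mu) / expR 1); last first.
  by field; rewrite !gt_eqF.
rewrite mulrA ler_pdivrMr //.
rewrite (_ : _ * expR 1 = (expR 1 * L) * (6 / m%:R * mu)); last by ring.
by rewrite ler_pM2r // mulr_gt0 // divr_gt0.
Qed.

End Deterministic.

(** * Measurability *)

Section ContinuousArith.
Variables (T : topologicalType) (U : numFieldType).
Implicit Types f g : T -> U.

Lemma fun_continuousD f g : continuous f -> continuous g ->
  continuous (fun x => f x + g x).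
Proof. by move=> cf cg x; exact: (cvgD (cf x) (cg x)). Qed.

Lemma fun_continuousB f g : continuous f -> continuous g ->
  continuous (fun x => f x - g x).
Proof. by move=> cf cg x; exact: (cvgB (cf x) (cg x)). Qed.

Lemma fun_continuousM f g : continuous f -> continuous g ->
  continuous (fun x => f x * g x).
Proof. by move=> cf cg x; exact: (cvgM (cf x) (cg x)). Qed.

Lemma fun_continuous_sum (I : Type) (s : seq I) (f : I -> T -> U) :
  (forall i, continuous (f i)) -> continuous (fun x => \sum_(i <- s) f i x).
Proof.
move=> cf; elim: s => [|i s IH].
  rewrite (_ : (fun _ => _) = cst 0); first exact: cst_continuous.
  by apply/funext => x; rewrite big_nil.
rewrite (_ : (fun _ => _) = (fun x => f i x + \sum_(j <- s) f j x)).
  exact: fun_continuousD.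
by apply/funext => x; rewrite big_cons.
Qed.

End ContinuousArith.

(** * Continuous and Borel functions on complex column vectors *)

Section BorelVectors.
Variables (R : realType) (n : nat).
Local Notation K := (R[i] : numFieldType).
Local Notation V := 'cV[K]_n.

Lemma Re_continuous : continuous (@complex.Re R : K -> R).
Proof.
move=> z; apply/(@cvgrPdist_lt _ _ K (nbhs z) (nbhs_filter z)) => e e0.
apply/nbhs_normP.
(* Balls of [K] have radii in [R[i]], so the real [e] enters as [e%:C]. *)
exists (e%:C : K); first by rewrite /= ltcR.
move=> w /= zw; rewrite -ReN -ReD -ltcR.
by apply: le_lt_trans zw; exact: normc_ge_Re.
Qed.

Lemma Im_continuous : continuous (@complex.Im R : K -> R).
Proof.
have -> : (@complex.Im R : K -> R) = (fun z : K => - Re (z * 'i%C)).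
  by apply/funext => z; rewrite ReiNIm opprK.
move=> z; apply: (@cvgN _ _ _ (nbhs z) (nbhs_filter z)).
exact: (cvg_comp _ _ (@mulrr_continuous K 'i%C z) (@Re_continuous (z * 'i%C))).
Qed.

Lemma mulmx_entry_continuous k (U : 'M[R[i]]_(k, n)) i j :
  continuous (fun x : V => ((U *m x) i j : K)).
Proof.
have -> : (fun x : V => ((U *m x) i j : K)) =
    (fun x : V => \sum_(l <- index_enum 'I_n) ((U i l : K) * (x l j : K))).
  by apply/funext => x; rewrite mxE.
apply: fun_continuous_sum => l; apply: fun_continuousM.
  exact: cst_continuous.
exact: (@coord_continuous K n 1 l j).
Qed.

Lemma mulmx_continuous_col (U : 'M[R[i]]_n) : continuous ((mulmx U : V -> V)).
Proof.
move=> x B [P hP PB].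
suff : nbhs x [set y | forall i j, P i j ((U *m y) i j)].
  by apply: (@filterS _ (nbhs x) (nbhs_filter x)) => y hy; apply: PB => i j; exact: hy.
have h i j : nbhs x [set y | P i j ((U *m y) i j)].
  exact: (@mulmx_entry_continuous n U i j x _ (hP i j)).
apply: (@filter_forall _ _ _ (nbhs x) (nbhs_filter x)) => i.
by apply: (@filter_forall _ _ _ (nbhs x) (nbhs_filter x)) => j; exact: h.
Qed.

Lemma open_measurable_cV (B : set V) : open B -> measurable (B : set (borel_cV R n)).
Proof. by move=> oB; apply: sub_sigma_algebra. Qed.

Lemma continuous_measurable_cV (f : V -> R) :
  continuous f -> measurable_fun setT (f : borel_cV R n -> R).
Proof.
move/continuousP => cf; apply: (measurability _ (RGenOpens.measurableE R)).
move=> _ [_ [a [b ->] <-]]; rewrite setTI; apply: open_measurable_cV.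
exact/cf/interval_open.
Qed.

Lemma mulmx_measurable (U : 'M[R[i]]_n) :
  measurable_fun setT (mulmx U : borel_cV R n -> borel_cV R n).
Proof.
apply: (@measurability _ _ (borel_cV R n) (borel_cV R n) setT _ (@open V)) => //.
move=> _ [B oB <-]; rewrite setTI; apply: open_measurable_cV.
by move/continuousP: (@mulmx_continuous_col U); apply.
Qed.

Lemma nsq_entry_continuous (U : 'M[R[i]]_n) j :
  continuous (fun x : V => nsq ((U *m x) j 0)).
Proof.
have c1 := @mulmx_entry_continuous n U j 0.
have cR : continuous (fun x : V => Re ((U *m x) j 0)).
  by move=> x; apply: (continuous_comp (c1 x)); exact: Re_continuous.
have cI : continuous (fun x : V => Im ((U *m x) j 0)).
  by move=> x; apply: (continuous_comp (c1 x)); exact: Im_continuous.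
rewrite /nsq; under eq_fun do rewrite !expr2.
by apply: fun_continuousD; apply: fun_continuousM.
Qed.

Lemma Re_entry_measurable j :
  measurable_fun setT (fun x : borel_cV R n => Re ((x : 'cV[R[i]]_n) j 0)).
Proof.
apply: continuous_measurable_cV => x.
apply: (@continuous_comp _ _ _ (fun x : V => (x j 0 : K)) (@complex.Re R : K -> R)).
  exact: (@coord_continuous K n 1 j 0).
exact: Re_continuous.
Qed.

Lemma Im_entry_measurable j :
  measurable_fun setT (fun x : borel_cV R n => Im ((x : 'cV[R[i]]_n) j 0)).
Proof.
apply: continuous_measurable_cV => x.
apply: (@continuous_comp _ _ _ (fun x : V => (x j 0 : K)) (@complex.Im R : K -> R)).
  exact: (@coord_continuous K n 1 j 0).
exact: Im_continuous.
Qed.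

Lemma sqnorm_measurable :
  measurable_fun setT (@sqnorm R n : borel_cV R n -> R).
Proof.
apply: continuous_measurable_cV.
have -> : (@sqnorm R n) = (fun x : V => \sum_(j <- index_enum 'I_n) nsq ((1%:M *m x) j 0)).
  apply/funext => x; apply: eq_bigr => j _.
  by rewrite mul1mx sqr_cmod.
by apply: fun_continuous_sum => j; exact: nsq_entry_continuous.
Qed.

Lemma sphere_measurable :
  measurable ([set x | sqnorm x = 1] : set (borel_cV R n)).
Proof.
have := sqnorm_measurable measurableT (measurable_set1 (1 : R)).
by rewrite setTI.
Qed.

End BorelVectors.

(** * Measurability of the Hausdorff event *)

Section EventMeasurable.
Variables (R : realType) (n : nat) (A : 'M[R[i]]_n).
Variables (phi : 'I_n -> 'cV[R[i]]_n) (lam : 'I_n -> R[i]).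
Hypothesis phi_on : forall i j, inner (phi i) (phi j) = (i == j)%:R.
Hypothesis lamE : forall j, A *m phi j = lam j *: phi j.

Local Notation kw b := (krylov_weights lam (weight phi b)).

Lemma weight_continuous j :
  continuous (weight phi ^~ j : 'cV[(R[i] : numFieldType)]_n -> R).
Proof. exact: nsq_entry_continuous. Qed.

(** Multiplying by the total weight clears the denominator and leaves an inequality polynomial in
    [g]; being strict, it also excludes total weight 0. *)
Lemma wavg_dist_ltP (g : 'I_n -> R) i (e : R) : 0 < e -> (forall j, 0 <= g j) ->
  (exists j, g j != 0) /\ cmod (lam i - wavg lam g) < e <->
  nsq (\sum_j (g j)%:C * (lam i - lam j)) < (e * \sum_j g j) ^+ 2.
Proof.
move=> e0 g0; have G0 : 0 <= \sum_j g j by exact: sumr_ge0.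
have [Gz|Gn] := eqVneq (\sum_j g j) 0.
  have gz j : g j = 0.
    move/eqP: Gz; rewrite psumr_eq0 // => /allP/(_ j).
    by rewrite mem_index_enum => /(_ isT)/eqP.
  split=> [[[j]]|]; first by rewrite gz eqxx.
  by rewrite Gz mulr0 expr0n /= ltNge nsq_ge0.
have Gp : 0 < \sum_j g j by rewrite lt_def Gn.
have E : \sum_j (g j)%:C * (lam i - lam j) = (\sum_j g j)%:C * (lam i - wavg lam g).
  have -> : (\sum_j g j)%:C * (lam i - wavg lam g) =
      \sum_j (g j)%:C * lam i - (\sum_j g j)%:C * wavg lam g.
    by rewrite mulrBr; congr (_ - _); rewrite rmorph_sum mulr_suml.
  rewrite /wavg mulr_sumr -sumrB.
  apply: eq_bigr => j _; rewrite mulrBr; congr (_ - _).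
  by rewrite mulrA -rmorphM mulrCA mulfV ?mulr1.
rewrite E nsqM nsqC exprMn mulrC ltr_pM2r ?exprn_gt0 // cmod_lt ?ltW //.
split=> [[]//|h]; split => //.
by move: Gn; rewrite psumr_neq0 // => /hasP[j _ /= h']; exists j; rewrite gt_eqF.
Qed.

(** For fixed [p] the condition is a strict inequality between continuous functions of [b]. The
    union over [p] is uncountable, which is harmless for open sets. *)
Lemma approx_open k i (e : R) : 0 < e ->
  open ([set b | exists2 p : {poly R[i]}, (size p <= k)%N &
     (exists j, kw b p j != 0) /\ cmod (lam i - wavg lam (kw b p)) < e]
   : set 'cV[(R[i] : numFieldType)]_n).
Proof.
move=> e0.
rewrite (_ : [set b | _] = \bigcup_(p in [set p : {poly R[i]} | (size p <= k)%N])
   [set b | nsq (\sum_j (kw b p j)%:C * (lam i - lam j))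
            < (e * \sum_j kw b p j) ^+ 2]); last first.
  have kw0 b p j : 0 <= kw b p j by rewrite mulr_ge0 ?nsq_ge0.
  by apply/seteqP; split=> b [p sp hp]; exists p => //; move: hp => /wavg_dist_ltP; exact.
apply: bigcup_open => p _.
have kwc j : continuous (fun b : 'cV[(R[i] : numFieldType)]_n => kw b p j).
  apply: fun_continuousM; first exact: cst_continuous.
  exact: weight_continuous.
pose S (c : 'I_n -> R) (b : 'cV[(R[i] : numFieldType)]_n) : R :=
  \sum_(j <- index_enum 'I_n) kw b p j * c j.
have Sc c : continuous (S c).
  apply: fun_continuous_sum => j; apply: fun_continuousM; first exact: kwc.
  exact: cst_continuous.
pose f b := (e * S (fun=> 1) b) ^+ 2 - (S (fun j => Re (lam i - lam j)) b ^+ 2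
   + S (fun j => Im (lam i - lam j)) b ^+ 2).
have -> : [set b | nsq (\sum_j (kw b p j)%:C * (lam i - lam j))
            < (e * \sum_j kw b p j) ^+ 2] = f @^-1` [set x | 0 < x].
  have SR b : Re (\sum_j (kw b p j)%:C * (lam i - lam j))
      = S (fun j => Re (lam i - lam j)) b.
    by rewrite Re_sum; apply: eq_bigr => j _; rewrite ReCM.
  have SI b : Im (\sum_j (kw b p j)%:C * (lam i - lam j))
      = S (fun j => Im (lam i - lam j)) b.
    by rewrite Im_sum; apply: eq_bigr => j _; rewrite ImCM.
  have S1 b : \sum_j kw b p j = S (fun=> 1) b.
    by apply: eq_bigr => j _; rewrite mulr1.
  by apply/seteqP; split=> b; rewrite /mkset /= /f subr_gt0 -SR -SI S1.
have cf : continuous f.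
  rewrite /f; under eq_fun do rewrite !expr2.
  apply: fun_continuousB; last by apply: fun_continuousD; apply: fun_continuousM.
  by apply: fun_continuousM; (apply: fun_continuousM; [exact: cst_continuous|]).
by move/continuousP: cf; apply; exact: open_gt.
Qed.

(** [Q] is an arbitrary choice of bases, eliminated in favour of polynomials by
    [numrange_compression]. In [hausdorff_leP] the slack can be restricted to the values 1 / (q +
    1), which makes the intersection countable. *)
Lemma hausdorff_event_measurable k (C : \bar R)
  (r : 'cV[R[i]]_n -> nat) (Q : forall b, 'M[R[i]]_(n, r b)) : (0 <= C)%E ->
  (forall b, krylov_orthobasis A b k (Q b)) ->
  measurable ([set b | hausdorff_dist (numrange (compression (Q b) A)) (numrange A) <= C]%E
    : set (borel_cV R n)).
Proof.
case: C => [e| |//] e0 hQ; last first.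
  rewrite (_ : [set b | _] = setT); first exact: measurableT.
  by apply/seteqP; split=> b //= _; exact: leey.
rewrite lee_fin in e0.
rewrite (_ : [set b | _] = \bigcap_(i in [set: 'I_n]) \bigcap_(q in [set: nat])
   [set b | exists2 p : {poly R[i]}, (size p <= k)%N &
     (exists j, kw b p j != 0) /\ cmod (lam i - wavg lam (kw b p)) < e + q.+1%:R^-1]).
  apply: fin_bigcap_measurable => // i _; apply: bigcap_measurable => // q _.
  apply: open_measurable_cV; apply: approx_open.
  by rewrite ltr_wpDl // invr_gt0 ltr0n.
apply/seteqP; split=> b /=.
  move/(hausdorff_compression_leP phi_on lamE e0 (hQ b)) => h i _ q _.
  have [|z] := h i q.+1%:R^-1; first by rewrite invr_gt0 ltr0n.
  by move=> /(numrange_compression phi_on lamE (hQ b))[p sp [pw ->]]; exists p.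
move=> h; apply/(hausdorff_compression_leP phi_on lamE e0 (hQ b)) => i eps ep0.
have [q hq] : exists q : nat, q.+1%:R^-1 < eps.
  exists (Num.truncn eps^-1).
  by rewrite invf_plt ?posrE ?ltr0n // truncnS_gt.
have [p sp [pw hp]] := h i I q I.
exists (wavg lam (kw b p)); last by rewrite (lt_trans hp) // ltrD2l.
by apply/(numrange_compression phi_on lamE (hQ b)); exists p.
Qed.

(** Allows the basis attached to an outcome to be replaced by one chosen from the vector alone. *)
Lemma numrange_compression_unique b k r (Q : 'M[R[i]]_(n, r))
  r' (Q' : 'M[R[i]]_(n, r')) : krylov_orthobasis A b k Q ->
  krylov_orthobasis A b k Q' ->
  numrange (compression Q A) = numrange (compression Q' A).
Proof.
move=> hQ hQ'; apply/seteqP; split=> z.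
  move/(numrange_compression phi_on lamE hQ) => h.
  exact/(numrange_compression phi_on lamE hQ').
move/(numrange_compression phi_on lamE hQ') => h.
exact/(numrange_compression phi_on lamE hQ).
Qed.

End EventMeasurable.

(** * Moments of a unitarily invariant law on the sphere *)

Section Expansion.
Variable R : realFieldType.
Implicit Types x y a b : R.

(** This and the next four lemmas bound an expression along its syntax tree, which is why constants
    below keep factors such as [4%:R * 1 * 1]. *)
Lemma bndM x y a b : `|x| <= a -> `|y| <= b -> `|x * y| <= a * b.
Proof. by move=> ha hb; rewrite normrM ler_pM. Qed.

Lemma bndD x y a b : `|x| <= a -> `|y| <= b -> `|x + y| <= a + b.
Proof. by move=> ha hb; rewrite (le_trans (ler_normD _ _)) // lerD. Qed.

Lemma bndN x a : `|x| <= a -> `|- x| <= a.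
Proof. by rewrite normrN. Qed.

Lemma bndX x k : `|x| <= 1 -> `|x ^+ k| <= 1.
Proof. by move=> h; rewrite normrX exprn_ile1. Qed.

Lemma bnd_nat k : `|k%:R : R| <= k%:R.
Proof. by rewrite ger0_norm. Qed.

(** First-order expansion in [sg] whose remainder constant depends on [k] alone. At k = 0 the factor
    [k%:R] kills the term containing [k.-1]. *)
Lemma power_expansion k : exists K : R, forall Z D Y sg rho,
  `|Z| <= 1 -> `|D| <= 1 -> `|Y| <= 1 -> `|sg| <= 1 -> `|rho| <= 4 ->
  exists2 r, `|r| <= K &
  (Y - 2 * sg * Z + sg ^+ 2 * rho * D) ^+ k =
  Y ^+ k - 2 * k%:R * sg * Z * Y ^+ k.-1 + sg ^+ 2 * r.
Proof.
elim: k => [|k [K IH]].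
  exists 0 => Z D Y sg rho _ _ _ _ _; exists 0; first by rewrite normr0.
  by rewrite !expr0; ring.
(* The base of the power is at most 7 = 1 + 2 + 4 in absolute value; the other summand bounds the
   new second-order terms. *)
exists (7%:R * K + (4%:R * 1 * 1 + 2%:R * k%:R * 1 * (2%:R * 1 + 1 * 4%:R * 1) * 1)).
move=> Z D Y sg rho hZ hD hY hs hr; have [r hK E] := IH Z D Y sg rho hZ hD hY hs hr.
exists ((Y - 2 * sg * Z + sg ^+ 2 * rho * D) * r + (rho * D * Y ^+ k
   + 2%:R * k%:R * Z * (2%:R * Z - sg * rho * D) * Y ^+ k.-1)).
  have h7 : `|Y - 2 * sg * Z + sg ^+ 2 * rho * D| <= 7%:R.
    have -> : 7%:R = 1 + 2%:R * 1 * 1 + 1 * 4%:R * 1 :> R by ring.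
    apply: bndD; first by apply: bndD => //; apply: bndN; do !apply: bndM => //; exact: bnd_nat.
    by do !apply: bndM => //; exact: bndX.
  apply: bndD; first exact: bndM.
  apply: bndD; first by do !apply: bndM => //; exact: bndX.
  apply: bndM; last exact: bndX.
  apply: bndM; first by do !apply: bndM => //; exact: bnd_nat.
  apply: bndD; first by apply: bndM => //; exact: bnd_nat.
  by apply: bndN; do !apply: bndM.
rewrite exprS E; case: k {IH E} => [|k] /=; first by rewrite expr0 expr1; ring.
by rewrite -(natr1 k.+1) !exprS; ring.
Qed.

(* The first factor and the base of the power are [Z] and [Y = 1 - |x_a|^2]
   after the reflection [plane_reflection], for [sg = C * S] and
   [rho = C ^- 2]. *)
Lemma product_expansion k : exists K : R, 0 <= K /\ forall Z D Y sg rho,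
  `|Z| <= 1 -> `|D| <= 1 -> `|Y| <= 1 -> `|sg| <= 1 -> `|rho| <= 4 ->
  `|(- Z + sg * D + 2 * sg ^+ 2 * rho * Z) * (Y - 2 * sg * Z + sg ^+ 2 * rho * D) ^+ k
    + Z * Y ^+ k - sg * (D * Y ^+ k + 2 * k%:R * (Z ^+ 2 * Y ^+ k.-1))| <= K * sg ^+ 2.
Proof.
have [K HK] := power_expansion k.
have K0 : 0 <= K.
  have [||||| r hr _] := HK 0 0 0 0 0; rewrite ?normr0 //.
  exact: le_trans (normr_ge0 _) hr.
pose B : R := 10%:R * K + 2%:R * 4%:R * 1 * 1 + 2%:R * k%:R * 1 * 1 * 1
  + 4%:R * k%:R * 1 * 4%:R * 1 * 1.
exists B; split.
  by rewrite /B !addr_ge0 ?mulr_ge0.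
move=> Z D Y sg rho hZ hD hY hs hr; have [r hK ->] := HK Z D Y sg rho hZ hD hY hs hr.
set W := (X in `|X| <= _).
have -> : W = sg ^+ 2 * ((- Z + sg * D + 2%:R * sg ^+ 2 * rho * Z) * r
    + 2%:R * rho * Z * Y ^+ k - 2%:R * k%:R * Z * D * Y ^+ k.-1
    - 4%:R * k%:R * sg * rho * Z ^+ 2 * Y ^+ k.-1) by rewrite /W; ring.
rewrite normrM (ger0_norm (sqr_ge0 sg)) [leRHS]mulrC ler_wpM2l ?sqr_ge0 //.
have n k' := @bnd_nat k'.
apply: bndD; last first.
  by apply: bndN; do !(apply: bndM; rewrite ?n ?bndX //).
apply: bndD; last first.
  by apply: bndN; do !(apply: bndM; rewrite ?n ?bndX //).
apply: bndD; last by do !(apply: bndM; rewrite ?n ?bndX //).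
apply: bndM => //.
have -> : 10%:R = 1 + 1 * 1 + 2%:R * 1 * 4%:R * 1 :> R by ring.
apply: bndD; last by do !(apply: bndM; rewrite ?n ?bndX //).
by apply: bndD; [exact: bndN | exact: bndM].
Qed.

(** Replaces the limit t -> 0. If c = |e| were positive, t = c / (2 (K + c + 1)) would give K t <
    c. *)
Lemma small_eq0 (K e : R) : 0 <= K ->
  (forall t, 0 < t <= 1 / 2 -> `|e| <= K * t) -> e = 0.
Proof.
move=> K0 h; apply/eqP; rewrite -normr_eq0 eq_le normr_ge0 andbT leNgt.
apply/negP => e0.
move: `|e| e0 h => c c0 h.
have K1 : 0 < 2 * (K + c + 1) by lra.
have ht : 0 < c / (2 * (K + c + 1)) <= 1 / 2.
  by rewrite divr_gt0 //= ler_pdivrMr //; lra.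
have := h _ ht; rewrite mulrA ler_pdivlMr //; nra.
Qed.

Lemma norm_sub_le1 x y : 0 <= x <= 1 -> 0 <= y <= 1 -> `|x - y| <= 1.
Proof.
by move=> /andP[? ?] /andP[? ?]; rewrite ler_norml; apply/andP; split; lra.
Qed.

End Expansion.

(** * Unitary reflections of a coordinate plane *)

Section Reflection.
Variables (R : realType) (n : nat).

Lemma conjcM (x y : R[i]) : conjc (x * y) = conjc x * conjc y.
Proof. exact: rmorphM. Qed.

(** A Householder reflection: [P *m P] is [sqnorm w] times [P], so the quadratic term cancels the
    two linear ones. *)
Lemma reflection_unitary (w : 'cV[R[i]]_n) : sqnorm w != 0 ->
  1%:M - (2 / sqnorm w)%:C *: (w *m w^t*) \is unitarymx.
Proof.
move=> w0; set s := (2 / sqnorm w)%:C; set P := w *m w^t*.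
have PP : P *m P = (sqnorm w)%:C *: P.
  rewrite /P mulmxA -(mulmxA w) [w^t* *m w]mx11_scalar dot_sqnorm.
  by rewrite mul_mx_scalar -scalemxAl.
have Pt : P^t* = P by rewrite /P trmx_mul map_mxM trmxCK.
have st : conjc s = s by rewrite /s conjc_real.
have ss : s * s * (sqnorm w)%:C = s + s.
  by rewrite /s -!rmorphM -rmorphD; congr (_%:C); field.
clearbody s P.
have Ut : (1%:M - s *: P)^t* = 1%:M - s *: P.
  apply/matrixP => i j; have /matrixP/(_ i j) := Pt; rewrite !mxE !conjCc => <-.
  by rewrite rmorphB rmorphM rmorph_nat /= st eq_sym.
apply/unitarymxP; rewrite Ut mulmxBl mul1mx mulmxBr mulmx1.
rewrite -scalemxAl -scalemxAr PP !scalerA ss scalerDl.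
by apply/matrixP => i j; rewrite !mxE; ring.
Qed.

(* [C] and [S] parametrize the circle rationally, which avoids square roots;
   [eta] is a phase, to be taken equal to [1] and to [i]. *)
Lemma plane_reflection (a j : 'I_n) (eta : R[i]) (t : R) : a != j -> nsq eta = 1 ->
  exists2 U : 'M[R[i]]_n, U \is unitarymx & forall x : 'cV[R[i]]_n,
  let C := (1 - t ^+ 2) / (1 + t ^+ 2) in let S := 2 * t / (1 + t ^+ 2) in
  (U *m x) a 0 = - (C%:C * x a 0 + S%:C * (conjc eta * x j 0)) /\
  conjc eta * (U *m x) j 0 = C%:C * (conjc eta * x j 0) - S%:C * x a 0.
Proof.
move=> aj e1.
(* The normal vector e_a + t eta e_j has squared norm [1 + t ^+ 2], the denominator of [C] and
   [S]. *)
pose w : 'cV[R[i]]_n := \col_i ((i == a)%:R + (i == j)%:R * (t%:C * eta)).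
have wa : w a 0 = 1 by rewrite mxE eqxx (negPf aj) mul0r addr0.
have wj : w j 0 = t%:C * eta by rewrite mxE eqxx eq_sym (negPf aj) mul1r add0r.
have wk i : i != a -> i != j -> w i 0 = 0.
  by move=> /negPf ia /negPf ij; rewrite mxE ia ij mul0r addr0.
clearbody w.
have sum2 (F : 'I_n -> R[i]) : (forall i, i != a -> i != j -> F i = 0) ->
    \sum_i F i = F a + F j.
  move=> F0; rewrite (bigD1 a) //= (bigD1 j) ?(eq_sym j) //= big1 ?addr0 //.
  by move=> i /andP[ia ij]; exact: F0.
have T0 : 0 < 1 + t ^+ 2 by rewrite ltr_pwDl ?sqr_ge0.
have nw : sqnorm w = 1 + t ^+ 2.
  apply: (@complexI R); rewrite -dot_sqnorm mxE sum2.
    rewrite !mxE !conjCc wa wj conjc1 mul1r rmorphD; congr (_ + _).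
    by rewrite mulJc nsqM e1 nsqC mulr1.
  by move=> i ia ij; rewrite wk ?mulr0.
have ee : conjc eta * eta = 1 by rewrite mulJc e1.
exists (1%:M - (2 / sqnorm w)%:C *: (w *m w^t*)).
  by apply: reflection_unitary; rewrite nw gt_eqF.
move=> x C S.
have wx : (w^t* *m x) 0 0 = x a 0 + t%:C * (conjc eta * x j 0).
  rewrite mxE sum2.
    rewrite !mxE !conjCc wa wj conjc1 mul1r; congr (_ + _).
    by rewrite conjcM conjc_real -mulrA.
  by move=> i ia ij; rewrite !mxE !conjCc wk // conjc0 mul0r.
have Ux i : ((1%:M - (2 / sqnorm w)%:C *: (w *m w^t*)) *m x) i 0
    = x i 0 - (2 / (1 + t ^+ 2))%:C * (w i 0 * (x a 0 + t%:C * (conjc eta * x j 0))).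
  rewrite mulmxBl mul1mx -scalemxAl -mulmxA nw [w^t* *m x]mx11_scalar wx.
  by rewrite mul_mx_scalar !mxE; ring.
have CE : C%:C = 1 - (2 / (1 + t ^+ 2))%:C * t%:C ^+ 2 :> R[i].
  rewrite -rmorphXn -rmorphM (_ : C = 1 - 2 / (1 + t ^+ 2) * t ^+ 2).
    by rewrite rmorphB rmorph1.
  by rewrite /C; field; rewrite gt_eqF.
have CE' : C%:C = (2 / (1 + t ^+ 2))%:C - 1 :> R[i].
  rewrite (_ : C = 2 / (1 + t ^+ 2) - 1); first by rewrite rmorphB rmorph1.
  by rewrite /C; field; rewrite gt_eqF.
have SE : S%:C = (2 / (1 + t ^+ 2))%:C * t%:C :> R[i].
  by rewrite -rmorphM; congr (_%:C); rewrite /S; field; rewrite gt_eqF.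
rewrite !Ux wa wj SE; move: (2 / _)%:C CE CE' => c CE CE'; split.
  by rewrite CE'; ring.
rewrite CE mulrBr.
have -> : conjc eta * (c * (t%:C * eta * (x a 0 + t%:C * (conjc eta * x j 0))))
  = (conjc eta * eta) * (c * (t%:C * (x a 0 + t%:C * (conjc eta * x j 0)))) by ring.
by rewrite ee; ring.
Qed.

End Reflection.

Definition csphere (R : realType) (n : nat) : set (borel_cV R n) :=
  [set x | sqnorm x = 1].

(** * Means over the sphere and the moments of one coordinate *)

Section SphereMoments.
Variables (R : realType) (n : nat) (mu : probability (borel_cV R n) R).
Local Notation csphere := (@csphere R n).
Hypothesis mu_sphere : mu csphere = 1%E.
Hypothesis mu_unitary : forall U : 'M[R[i]]_n, U \is unitarymx ->
  forall E : set (borel_cV R n), measurable E ->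
  mu [set x : 'cV[R[i]]_n | E (U *m x)] = mu E.

Definition smean (f : borel_cV R n -> R) : R := \int[mu]_(x in csphere) f x.

(** Boundedness is asked on the sphere only: it carries all the mass, and coordinates are unbounded
    off it. *)
Definition sphere_bounded (f : borel_cV R n -> R) : Prop :=
  measurable_fun setT f /\ exists K, forall x, csphere x -> `|f x| <= K.

Implicit Types f g : borel_cV R n -> R.

Lemma csphere_measurable : measurable csphere.
Proof. exact: sphere_measurable. Qed.

Lemma sphere_bounded_integrable f : sphere_bounded f ->
  mu.-integrable csphere (EFin \o f).
Proof.
move=> [mf [K hK]]; apply: measurable_bounded_integrable.
- exact: csphere_measurable.
- by rewrite [X in (X < _)%E]mu_sphere ltry.
- exact: measurable_funTS.
- exists K; split; first exact: num_real.
  by move=> y Ky x xS; exact: le_trans (hK x xS) (ltW Ky).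
Qed.

Lemma sphere_bounded_cst c : sphere_bounded (fun=> c).
Proof. by split; [exact: measurable_cst | exists `|c|]. Qed.

Lemma sphere_boundedD f g : sphere_bounded f -> sphere_bounded g ->
  sphere_bounded (fun x => f x + g x).
Proof.
move=> [mf [K hK]] [mg [L hL]]; split; first exact: measurable_funD.
by exists (K + L) => x xS; apply: bndD; [exact: hK | exact: hL].
Qed.

Lemma sphere_boundedM f g : sphere_bounded f -> sphere_bounded g ->
  sphere_bounded (fun x => f x * g x).
Proof.
move=> [mf [K hK]] [mg [L hL]]; split; first exact: measurable_funM.
by exists (K * L) => x xS; apply: bndM; [exact: hK | exact: hL].
Qed.

Lemma sphere_boundedZ c f : sphere_bounded f -> sphere_bounded (fun x => c * f x).
Proof. by move=> bf; apply: sphere_boundedM => //; exact: sphere_bounded_cst. Qed.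

Lemma sphere_boundedB f g : sphere_bounded f -> sphere_bounded g ->
  sphere_bounded (fun x => f x - g x).
Proof.
move=> bf bg; rewrite (_ : (fun x => _) = (fun x => f x + (-1) * g x)).
  by apply: sphere_boundedD => //; exact: sphere_boundedZ.
by apply/funext => x; rewrite mulN1r.
Qed.

Lemma sphere_boundedX f k : sphere_bounded f -> sphere_bounded (fun x => f x ^+ k).
Proof.
move=> bf; elim: k => [|k IH].
  rewrite (_ : (fun x => _) = fun=> 1); first exact: sphere_bounded_cst.
  by apply/funext => x; rewrite expr0.
rewrite (_ : (fun x => _) = (fun x => f x * f x ^+ k)).
  exact: sphere_boundedM.
by apply/funext => x; rewrite exprS.
Qed.

Lemma nsq_entry_le1 x j : csphere x -> nsq ((x : 'cV[R[i]]_n) j 0) <= 1.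
Proof.
rewrite /csphere /= /sqnorm (bigD1 j) //= sqr_cmod => <-.
by rewrite lerDl sumr_ge0 // => i _; rewrite sqr_cmod nsq_ge0.
Qed.

Lemma sphere_bounded_Re j :
  sphere_bounded (fun x => Re ((x : 'cV[R[i]]_n) j 0)).
Proof.
split; first exact: Re_entry_measurable.
exists 1 => x /(nsq_entry_le1 j); rewrite /nsq => h.
rewrite -(ler_pXn2r (n := 2)) ?nnegrE // expr1n real_normK ?num_real //.
by rewrite (le_trans _ h) // lerDl sqr_ge0.
Qed.

Lemma sphere_bounded_Im j :
  sphere_bounded (fun x => Im ((x : 'cV[R[i]]_n) j 0)).
Proof.
split; first exact: Im_entry_measurable.
exists 1 => x /(nsq_entry_le1 j); rewrite /nsq => h.
rewrite -(ler_pXn2r (n := 2)) ?nnegrE // expr1n real_normK ?num_real //.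
by rewrite (le_trans _ h) // lerDr sqr_ge0.
Qed.

Lemma sphere_bounded_nsq j :
  sphere_bounded (fun x => nsq ((x : 'cV[R[i]]_n) j 0)).
Proof.
apply: sphere_boundedD; apply: sphere_boundedX.
  exact: sphere_bounded_Re.
exact: sphere_bounded_Im.
Qed.

Lemma sqnorm_unitary (U : 'M[R[i]]_n) x : U \is unitarymx -> sqnorm (U *m x) = sqnorm x.
Proof.
move=> uU; have UU : U^t* *m U = 1%:M by exact/mulmx1C/unitarymxP.
apply: (@complexI R); rewrite -!dot_sqnorm trmx_mul map_mxM.
by rewrite -mulmxA (mulmxA _ U) UU mul1mx.
Qed.

Lemma sphere_bounded_unitary f (U : 'M[R[i]]_n) : U \is unitarymx ->
  sphere_bounded f -> sphere_bounded (fun x => f (U *m x)).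
Proof.
move=> uU [mf [K hK]]; split.
  exact: (measurableT_comp mf (@mulmx_measurable R n U)).
by exists K => x xS; apply: hK; rewrite /csphere /= sqnorm_unitary.
Qed.

Lemma smeanD f g : sphere_bounded f -> sphere_bounded g ->
  smean (fun x => f x + g x) = smean f + smean g.
Proof.
move=> bf bg; apply: RintegralD; first exact: csphere_measurable.
  exact: sphere_bounded_integrable.
exact: sphere_bounded_integrable.
Qed.

Lemma smeanZ c f : sphere_bounded f -> smean (fun x => c * f x) = c * smean f.
Proof.
move=> bf; apply: RintegralZl; first exact: csphere_measurable.
exact: sphere_bounded_integrable.
Qed.

Lemma smeanB f g : sphere_bounded f -> sphere_bounded g ->
  smean (fun x => f x - g x) = smean f - smean g.
Proof.
move=> bf bg; rewrite (_ : (fun x => _) = (fun x => f x + (-1) * g x)).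
  by rewrite smeanD ?smeanZ ?mulN1r //; exact: sphere_boundedZ.
by apply/funext => x; rewrite mulN1r.
Qed.

Lemma smean_sum (I : Type) (s : seq I) (F : I -> borel_cV R n -> R) :
  (forall i, sphere_bounded (F i)) ->
  sphere_bounded (fun x => \sum_(i <- s) F i x) /\
  smean (fun x => \sum_(i <- s) F i x) = \sum_(i <- s) smean (F i).
Proof.
move=> bF; elim: s => [|i s [bs IH]].
  rewrite (_ : (fun x => _) = fun=> 0); last by apply/funext => x; rewrite big_nil.
  split; first exact: sphere_bounded_cst.
  rewrite /smean big_nil Rintegral_cst; last exact: csphere_measurable.
  by rewrite mul0r.
rewrite (_ : (fun x => _) = (fun x => F i x + \sum_(j <- s) F j x)); last first.
  by apply/funext => x; rewrite big_cons.
by split; [exact: sphere_boundedD | rewrite smeanD // IH big_cons].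
Qed.

Lemma smean_cst c : smean (fun=> c) = c.
Proof.
rewrite /smean Rintegral_cst; last exact: csphere_measurable.
by rewrite [X in fine X]mu_sphere mulr1.
Qed.

Lemma eq_smean f g : (forall x, csphere x -> f x = g x) -> smean f = smean g.
Proof. by move=> h; apply: eq_Rintegral => x /[!inE]; exact: h. Qed.

Lemma smean_le_norm f K : sphere_bounded f -> (forall x, csphere x -> `|f x| <= K) ->
  `|smean f| <= K.
Proof.
move=> bf hK; have fi := sphere_bounded_integrable bf.
have Ki := sphere_bounded_integrable (sphere_bounded_cst K).
have NKi := sphere_bounded_integrable (sphere_bounded_cst (- K)).
rewrite ler_norml -{1}(smean_cst (- K)) -{2}(smean_cst K).
by apply/andP; split; apply: le_Rintegral => //;
  [exact: csphere_measurable | move=> x /hK /ler_normlP[] | exact: csphere_measurable |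
   move=> x /hK /ler_normlP[]]; lra.
Qed.

(** Change of variables: [U] preserves the sphere, and the pushforward of [mu] along [U] agrees with
    [mu] on Borel sets. *)
Lemma smean_unitary f (U : 'M[R[i]]_n) : U \is unitarymx -> sphere_bounded f ->
  smean (fun x => f (U *m x)) = smean f.
Proof.
move=> uU bf; have [mf _] := bf.
have mU := mulmx_measurable U.
have preS : (mulmx U : borel_cV R n -> borel_cV R n) @^-1` csphere = csphere.
  by apply/seteqP; split=> x; rewrite /csphere /= sqnorm_unitary.
have fi : mu.-integrable ((mulmx U : borel_cV R n -> borel_cV R n) @^-1` csphere)
    ((EFin \o f) \o (mulmx U : borel_cV R n -> borel_cV R n)).
  rewrite preS; exact: (sphere_bounded_integrable (sphere_bounded_unitary uU bf)).
have mEf : measurable_fun setT (EFin \o f) by exact/measurable_EFinP.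
have := integral_pushforward mU mEf fi csphere_measurable.
rewrite preS => h; rewrite /smean /Rintegral; congr fine.
rewrite -[LHS]/(\int[mu]_(x in csphere) ((EFin \o f) \o mulmx U) x)%E -h.
by apply: eq_measure_integral => E mE _; exact: mu_unitary.
Qed.

Section PairIdentity.
Variables (a j : 'I_n) (eta : R[i]).
Hypotheses (aj : a != j) (eta1 : nsq eta = 1).

(** With p = x_a and q = conj(eta) x_j, the reflected a-th coordinate has squared modulus C^2 |p|^2
    + S^2 |q|^2 + 2 C S [Z], so [Z] is the cross term. *)
Let Z (x : borel_cV R n) : R :=
  Re (conjc (conjc eta * (x : 'cV[R[i]]_n) j 0) * (x : 'cV[R[i]]_n) a 0).
Let D (x : borel_cV R n) : R :=
  nsq ((x : 'cV[R[i]]_n) a 0) - nsq ((x : 'cV[R[i]]_n) j 0).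
Let Y (x : borel_cV R n) : R := 1 - nsq ((x : 'cV[R[i]]_n) a 0).

Let bY : sphere_bounded Y.
Proof.
apply: sphere_boundedB; first exact: sphere_bounded_cst.
exact: sphere_bounded_nsq.
Qed.

Let bD : sphere_bounded D.
Proof. by apply: sphere_boundedB; exact: sphere_bounded_nsq. Qed.

Let bZ : sphere_bounded Z.
Proof.
rewrite (_ : Z = fun x => Re eta * (Re ((x : 'cV[R[i]]_n) j 0) * Re ((x : 'cV[R[i]]_n) a 0)
    + Im ((x : 'cV[R[i]]_n) j 0) * Im ((x : 'cV[R[i]]_n) a 0))
  + Im eta * (Im ((x : 'cV[R[i]]_n) j 0) * Re ((x : 'cV[R[i]]_n) a 0)
    - Re ((x : 'cV[R[i]]_n) j 0) * Im ((x : 'cV[R[i]]_n) a 0))); last first.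
  apply/funext => x; rewrite /Z.
  move: ((x : 'cV[R[i]]_n) j 0) ((x : 'cV[R[i]]_n) a 0) (eta) => [x1 x2] [y1 y2] [e1 e2].
  by rewrite !ReImE /=; ring.
have bR := sphere_bounded_Re; have bI := sphere_bounded_Im.
apply: sphere_boundedD; apply: sphere_boundedZ.
  by apply: sphere_boundedD; exact: sphere_boundedM.
by apply: sphere_boundedB; exact: sphere_boundedM.
Qed.

Let Z1 x : csphere x -> `|Z x| <= 1.
Proof.
move=> xS; have ha := nsq_entry_le1 a xS; have hj := nsq_entry_le1 j xS.
rewrite -(ler_pXn2r (n := 2)) ?nnegrE // expr1n real_normK ?num_real //.
apply: (@le_trans _ _ (nsq (conjc (conjc eta * (x : 'cV[R[i]]_n) j 0)
                            * (x : 'cV[R[i]]_n) a 0))).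
  by rewrite /nsq lerDl sqr_ge0.
by rewrite nsqM nsqJ nsqM nsqJ eta1 mul1r mulr_ile1 ?nsq_ge0.
Qed.

(* The means of [f] and of its composition with the reflection [U] agree for
   [f = Z * Y ^+ k]; dividing the expansion at small angle by the angle leaves
   the identity. *)
Lemma smean_pair k :
  sphere_bounded (fun x => D x * Y x ^+ k + 2 * k%:R * (Z x ^+ 2 * Y x ^+ k.-1)) /\
  smean (fun x => D x * Y x ^+ k + 2 * k%:R * (Z x ^+ 2 * Y x ^+ k.-1)) = 0.
Proof.
pose f x := Z x * Y x ^+ k.
pose g x := D x * Y x ^+ k + 2 * k%:R * (Z x ^+ 2 * Y x ^+ k.-1).
have bf : sphere_bounded f.
  by apply: sphere_boundedM => //; exact: sphere_boundedX.
have bg : sphere_bounded g.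
  apply: sphere_boundedD.
    by apply: sphere_boundedM => //; exact: sphere_boundedX.
  by apply: sphere_boundedZ; apply: sphere_boundedM; exact: sphere_boundedX.
split=> //.
have [K [K0 HK]] := product_expansion R k.
pose C t : R := (1 - t ^+ 2) / (1 + t ^+ 2); pose S t : R := 2 * t / (1 + t ^+ 2).
have expand t U : (forall x : 'cV[R[i]]_n,
    (U *m x) a 0 = - ((C t)%:C * x a 0 + (S t)%:C * (conjc eta * x j 0)) /\
    conjc eta * (U *m x) j 0 = (C t)%:C * (conjc eta * x j 0) - (S t)%:C * x a 0) ->
  forall x : borel_cV R n,
    Z (U *m x) = - Z x + C t * S t * D x + (1 + S t ^+ 2 - C t ^+ 2) * Z x /\
    Y (U *m x) = 1 - C t ^+ 2 * nsq ((x : 'cV[R[i]]_n) a 0)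
       - S t ^+ 2 * nsq ((x : 'cV[R[i]]_n) j 0) - 2 * (C t * S t) * Z x.
  move=> hU x; have [ha hj] := hU x.
  have nj : nsq ((x : 'cV[R[i]]_n) j 0) = nsq (conjc eta * (x : 'cV[R[i]]_n) j 0).
    by rewrite nsqM nsqJ eta1 mul1r.
  rewrite /Z /Y /D nj hj ha; move: (conjc eta * _) (x a 0) (C t) (S t) => [q1 q2] [p1 p2] c s.
  by split; rewrite /nsq !ReImE /=; ring.
have CS t : C t ^+ 2 + S t ^+ 2 = 1.
  rewrite /C /S; field; rewrite gt_eqF // ltr_pwDl ?sqr_ge0 //.
(* At t = 0 the reflection only changes the sign of x_a, so [Z] becomes [- Z] while [Y] is fixed. *)
have f0 : smean f = 0.
  have [U uU hU] := plane_reflection 0 aj eta1.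
  have := smean_unitary uU bf.
  rewrite (_ : (fun x => f (U *m x)) = fun x => (-1) * f x).
    by rewrite smeanZ // => h; lra.
  apply/funext => x; rewrite /f; have [-> ->] := expand 0 U hU x.
  have -> : C 0 = 1 by rewrite /C expr0n subr0 addr0 divr1.
  have -> : S 0 = 0 by rewrite /S mulr0 mul0r.
  rewrite /Y (_ : _ - _ - _ - _ = 1 - nsq ((x : 'cV[R[i]]_n) a 0)); last by ring.
  by ring.
have [K' [K'0 HK']] : exists K', 0 <= K' /\ K' = K * 2.
  by exists (K * 2); rewrite mulr_ge0.
apply: (small_eq0 K'0) => t /andP[t0 t2].
have [U uU hU] := plane_reflection t aj eta1.
have T0 : 0 < 1 + t ^+ 2 by rewrite ltr_pwDl ?sqr_ge0.
have t4 : t ^+ 2 <= 1 / 4 by rewrite expr2; nra.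
have C2 : 1 / 2 <= C t by rewrite /C ler_pdivlMr //; lra.
have C1 : C t <= 1 by rewrite /C ler_pdivrMr //; have := sqr_ge0 t; lra.
have S0 : 0 < S t by rewrite /S divr_gt0 // mulr_gt0.
have S2 : S t <= 2 * t.
  by rewrite /S ler_pdivrMr //; have := sqr_ge0 t; nra.
(* [sg] is the small parameter, at most [2 * t]; the [rho] below satisfies
   [sg ^+ 2 * rho = S t ^+ 2] and is at most 4 because [C t >= 1 / 2]. *)
pose sg := C t * S t.
have C0 : 0 < C t by lra.
have sg0 : 0 < sg by rewrite mulr_gt0.
have sg2 : sg <= 2 * t.
  by rewrite (le_trans _ S2) // ler_piMl // ltW.
pose rho := (C t ^+ 2)^-1.
have rhoE : sg ^+ 2 * rho = S t ^+ 2.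
  by rewrite /sg /rho exprMn mulrAC mulfV ?mul1r // expf_neq0 // gt_eqF.
have rho4 : `|rho| <= 4.
  rewrite ger0_norm ?invr_ge0 ?sqr_ge0 // -[leRHS]invrK lef_pV2 ?posrE ?invr_gt0 ?exprn_gt0 //.
  by rewrite expr2; nra.
have sg1 : `|sg| <= 1 by rewrite ger0_norm ?(ltW sg0) // (le_trans sg2) //; lra.
pose h x := f (U *m x) + f x - sg * g x.
have bfU := sphere_bounded_unitary uU bf.
have bh : sphere_bounded h.
  apply: sphere_boundedB; last exact: sphere_boundedZ.
  exact: sphere_boundedD.
have hE : smean h = - sg * smean g.
  rewrite /h smeanB; [|exact: sphere_boundedD|exact: sphere_boundedZ].
  by rewrite smeanD // smean_unitary // f0 smeanZ //; ring.
(* As [smean h = - sg * smean g], dividing this second-order bound by [sg] leaves |smean g| <= K sg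
   <= 2 K t. *)
have : `|smean h| <= K * sg ^+ 2.
  apply: smean_le_norm => // x xS.
  have ha := nsq_entry_le1 a xS; have hj := nsq_entry_le1 j xS.
  have hD : `|D x| <= 1 by apply: norm_sub_le1; rewrite nsq_ge0 ?ha ?hj.
  have hY : `|Y x| <= 1 by apply: norm_sub_le1; rewrite ?nsq_ge0 ?ha ?lexx ?ler01.
  have := HK (Z x) (D x) (Y x) sg rho (Z1 xS) hD hY sg1 rho4.
  rewrite /h /f /g; have [-> ->] := expand t U hU x.
  have := CS t; rewrite rhoE (_ : 2 * sg ^+ 2 * rho = 2 * S t ^+ 2) -?/sg => [hCS|]; last first.
    by rewrite -mulrA rhoE.
  have -> : 1 + S t ^+ 2 - C t ^+ 2 = 2 * S t ^+ 2 by lra.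
  have -> : 1 - C t ^+ 2 * nsq ((x : 'cV[R[i]]_n) a 0)
       - S t ^+ 2 * nsq ((x : 'cV[R[i]]_n) j 0) - 2 * sg * Z x
     = Y x - 2 * sg * Z x + S t ^+ 2 * D x.
    by rewrite (_ : C t ^+ 2 = 1 - S t ^+ 2) /Y /D; [ring | lra].
  by [].
rewrite hE normrM normrN (ger0_norm (ltW sg0)) expr2 mulrCA ler_pM2l //.
by move=> hh; rewrite (le_trans hh) // HK' -mulrA ler_wpM2l.
Qed.

End PairIdentity.

Definition sphere_moment (a : 'I_n) (k : nat) : R :=
  smean (fun x => (1 - nsq ((x : 'cV[R[i]]_n) a 0)) ^+ k).

Lemma nsq_i : nsq ('i%C : R[i]) = 1.
Proof. by rewrite /nsq /= expr0n expr1n add0r. Qed.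

(** Adds [smean_pair] for the phases 1 and i: the squares of the real and imaginary parts of
    conj(x_j) x_a sum to |x_j|^2 |x_a|^2. *)
Lemma smean_exchange a j k : a != j ->
  smean (fun x => (nsq ((x : 'cV[R[i]]_n) j 0) - nsq ((x : 'cV[R[i]]_n) a 0))
                  * (1 - nsq ((x : 'cV[R[i]]_n) a 0)) ^+ k)
  = k%:R * smean (fun x => nsq ((x : 'cV[R[i]]_n) j 0) * (nsq ((x : 'cV[R[i]]_n) a 0)
                  * (1 - nsq ((x : 'cV[R[i]]_n) a 0)) ^+ k.-1)).
Proof.
move=> aj.
have e1 : nsq (1 : R[i]) = 1 by rewrite /nsq /= expr0n expr1n addr0.
have h1 := smean_pair aj e1 k; have h2 := smean_pair aj nsq_i k.
have bn := sphere_bounded_nsq.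
have bYk l : sphere_bounded (fun x => (1 - nsq ((x : 'cV[R[i]]_n) a 0)) ^+ l).
  apply: sphere_boundedX; apply: sphere_boundedB => //; exact: sphere_bounded_cst.
set u := (fun x : borel_cV R n => _ * _ ^+ k); set v := (fun x => _ * (_ * _)).
have bu : sphere_bounded u by apply: sphere_boundedM => //; exact: sphere_boundedB.
have bv : sphere_bounded v by apply: sphere_boundedM => //; exact: sphere_boundedM.
have [b1 {}h1] := h1; have [b2 {}h2] := h2.
suff : smean (fun x => (-2) * u x + 2 * k%:R * v x) = 0.
  by rewrite smeanD ?smeanZ //; [lra | exact: sphere_boundedZ | exact: sphere_boundedZ].
rewrite -[RHS]addr0 -{1}h1 -h2 -smeanD //; apply: eq_smean => x _.
rewrite /u /v; move: (x a 0) (x j 0) => [p1 p2] [q1 q2].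
by rewrite /nsq !ReImE /=; ring.
Qed.

(** Sum [smean_exchange] over all j other than a: on the sphere the |x_j|^2 add up to 1 - |x_a|^2,
    so only powers of this quantity remain. *)
Lemma sphere_moment_rec a k :
  (n + k)%:R * sphere_moment a k.+1 = (n.-1 + k)%:R * sphere_moment a k.
Proof.
have n0 : (0 < n)%N by apply: leq_ltn_trans (ltn_ord a).
have bn := sphere_bounded_nsq.
have bY l : sphere_bounded (fun x => (1 - nsq ((x : 'cV[R[i]]_n) a 0)) ^+ l).
  apply: sphere_boundedX; apply: sphere_boundedB => //; exact: sphere_bounded_cst.
pose u j (x : borel_cV R n) := (nsq ((x : 'cV[R[i]]_n) j 0) - nsq ((x : 'cV[R[i]]_n) a 0))
                  * (1 - nsq ((x : 'cV[R[i]]_n) a 0)) ^+ k.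
pose v j (x : borel_cV R n) := nsq ((x : 'cV[R[i]]_n) j 0) * (nsq ((x : 'cV[R[i]]_n) a 0)
                  * (1 - nsq ((x : 'cV[R[i]]_n) a 0)) ^+ k.-1).
have bu j : sphere_bounded (u j).
  by apply: sphere_boundedM => //; exact: sphere_boundedB.
have bv j : sphere_bounded (v j) by apply: sphere_boundedM => //; exact: sphere_boundedM.
have sumN (x : borel_cV R n) : csphere x ->
    \sum_(j | j != a) nsq ((x : 'cV[R[i]]_n) j 0) = 1 - nsq ((x : 'cV[R[i]]_n) a 0).
  rewrite /csphere /= => <-; rewrite /sqnorm [X in _ = X - _](bigD1 a) //= sqr_cmod.
  by rewrite [RHS]addrC addKr; apply: eq_bigr => j _; rewrite sqr_cmod.
have [_ su] := smean_sum [seq j <- index_enum 'I_n | j != a] bu.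
have [_ sv] := smean_sum [seq j <- index_enum 'I_n | j != a] bv.
have E : \sum_(j <- [seq j <- index_enum 'I_n | j != a]) smean (u j) =
    k%:R * \sum_(j <- [seq j <- index_enum 'I_n | j != a]) smean (v j).
  rewrite !big_filter mulr_sumr; apply: eq_bigr => j ja.
  by apply: smean_exchange; rewrite eq_sym.
move: E; rewrite -su -sv.
have -> : smean (fun x => \sum_(j <- [seq j <- index_enum 'I_n | j != a]) u j x)
    = smean (fun x => n%:R * (1 - nsq ((x : 'cV[R[i]]_n) a 0)) ^+ k.+1
        - n.-1%:R * (1 - nsq ((x : 'cV[R[i]]_n) a 0)) ^+ k).
  apply: eq_smean => x xS; rewrite big_filter /u -mulr_suml big_split /= sumN //.
  rewrite sumr_const cardC1 card_ord exprS -[(- _) *+ _]mulr_natl.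
  rewrite (_ : n%:R = n.-1%:R + 1 :> R); last by rewrite natr1 prednK.
  by ring.
have -> : smean (fun x => \sum_(j <- [seq j <- index_enum 'I_n | j != a]) v j x)
    = smean (fun x => (1 - nsq ((x : 'cV[R[i]]_n) a 0)) ^+ k.-1.+1
        - (1 - nsq ((x : 'cV[R[i]]_n) a 0)) ^+ k.-1.+2).
  apply: eq_smean => x xS; rewrite big_filter /v -mulr_suml sumN // !exprS.
  by ring.
rewrite !smeanB ?smeanZ //; try exact: sphere_boundedZ.
rewrite -!/(sphere_moment a _).
(* For k = 0 the exponents [k.-1.+1] and [k] differ, but the factor [k%:R] vanishes. *)
have kk : k%:R * (sphere_moment a k.-1.+1 - sphere_moment a k.-1.+2) =
    k%:R * (sphere_moment a k - sphere_moment a k.+1).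
  by case: (k) => [|l] //; rewrite !mul0r.
by rewrite kk !natrD => h; lra.
Qed.

(** The recursion telescopes to the moments of the Beta(n - 1, 1) law. *)
Lemma sphere_momentE a k : (1 < n)%N ->
  sphere_moment a k = n.-1%:R / (n.-1 + k)%:R.
Proof.
move=> n1; have n0 : (0 < n.-1)%N by rewrite -subn1 subn_gt0.
have nz l : (n.-1 + l)%:R != 0 :> R by rewrite pnatr_eq0 -lt0n ltn_addr.
elim: k => [|k IH].
  rewrite addn0 divff; last by have := nz 0%N; rewrite addn0.
  rewrite /sphere_moment -[RHS](smean_cst 1); apply: eq_smean => x _.
  by rewrite expr0.
have := sphere_moment_rec a k.
have -> : (n + k = n.-1 + k.+1)%N by rewrite addnS -addSn prednK // ltnW.
rewrite IH mulrCA mulfV // mulr1 => h.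
by apply: (mulfI (nz k.+1)); rewrite h mulrCA mulfV ?mulr1.
Qed.

(** Markov's inequality for the k-th power of 1 - |x_a|^2, which is at least [(1 - t) ^+ k] on the
    event. *)
Lemma small_entry_le a (t : R) k : (1 < n)%N -> 0 < t < 1 ->
  (mu [set x | csphere x /\ (nsq ((x : 'cV[R[i]]_n) a 0%R) < t)%R]
   <= (n.-1%:R / (n.-1 + k)%:R / (1 - t) ^+ k)%:E)%E.
Proof.
move=> n1 /andP[t0 t1].
have mS := csphere_measurable.
have mB : measurable (csphere `&` [set x | nsq ((x : 'cV[R[i]]_n) a 0) < t]).
  apply: measurableI => //; have [mf _] := sphere_bounded_nsq a.
  have := mf measurableT _ (measurable_itv `]-oo, t[).
  by rewrite setTI; congr (measurable _); apply/seteqP.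
pose B := csphere `&` [set x | nsq ((x : 'cV[R[i]]_n) a 0) < t].
rewrite -/B in mB.
suff : (mu B <= (n.-1%:R / (n.-1 + k)%:R / (1 - t) ^+ k)%:E)%E by [].
have q0 : 0 < (1 - t) ^+ k by rewrite exprn_gt0 // subr_gt0.
have bY : sphere_bounded (fun x => (1 - nsq ((x : 'cV[R[i]]_n) a 0)) ^+ k).
  apply: sphere_boundedX; apply: sphere_boundedB; first exact: sphere_bounded_cst.
  exact: sphere_bounded_nsq.
have [mY _] := bY.
have Y0 x : csphere x -> 0 <= (1 - nsq ((x : 'cV[R[i]]_n) a 0)) ^+ k.
  by move=> xS; rewrite exprn_ge0 // subr_ge0; exact: nsq_entry_le1.
rewrite -(sphere_momentE a k n1) EFinM lee_pdivlMr //.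
have -> : (sphere_moment a k)%:E =
    (\int[mu]_(x in csphere) ((1 - nsq ((x : 'cV[R[i]]_n) a 0)) ^+ k)%:E)%E.
  rewrite /sphere_moment /smean /Rintegral fineK //.
  exact: (integrable_fin_num csphere_measurable (sphere_bounded_integrable bY)).
rewrite muleC -integral_cst //.
apply: (@le_trans _ _ (\int[mu]_(x in B) ((1 - nsq ((x : 'cV[R[i]]_n) a 0)) ^+ k)%:E)%E).
  apply: ge0_le_integral => //.
  - by move=> x _; rewrite /= lee_fin ltW.
  - by apply/measurable_EFinP; exact: measurable_funTS.
  - move=> x [xS xt]; rewrite /= lee_fin lerXn2r ?nnegrE ?subr_ge0 ?(ltW t1) //.
      exact: nsq_entry_le1.
    by rewrite lerD2l lerN2 ltW.
apply: ge0_subset_integral => //.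
- by apply/measurable_EFinP; exact: measurable_funTS.
- by move=> x [].
Qed.

End SphereMoments.

(** * Small ball estimate *)

Section TailConstants.
Variable R : realType.

(** Starts from [127 / 128 <= expR (- (1 / 128))] and squares seven times, rounding down; this gives
    0.3662 <= 1 / e. *)
Lemma expR1_le : expR 1 <= (273 + 1 / 2) / 100 :> R.
Proof.
have step (x a b : R) : a <= x -> 0 <= a -> b <= a * a -> b <= x ^+ 2.
  by move=> ax a0 h; rewrite (le_trans h) // expr2 ler_pM.
have e0 : 127 / 128 <= expR (- (1 / 128)) :> R.
  by rewrite (le_trans _ (expR_ge1Dx _)) //; lra.
have {e0}e1 := step _ _ ((984 + 43 / 100) / 1000) e0 ltac:(lra) ltac:(lra).
have {e1}e2 := step _ _ ((969 + 10 / 100) / 1000) e1 ltac:(lra) ltac:(lra).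
have {e2}e3 := step _ _ ((939 + 15 / 100) / 1000) e2 ltac:(lra) ltac:(lra).
have {e3}e4 := step _ _ ((882 + 0 / 100) / 1000) e3 ltac:(lra) ltac:(lra).
have {e4}e5 := step _ _ ((777 + 92 / 100) / 1000) e4 ltac:(lra) ltac:(lra).
have {e5}e6 := step _ _ ((605 + 15 / 100) / 1000) e5 ltac:(lra) ltac:(lra).
have {e6}e7 := step _ _ ((366 + 20 / 100) / 1000) e6 ltac:(lra) ltac:(lra).
have h : (366 + 20 / 100) / 1000 <= expR (- 1) :> R.
  have -> : - 1 = 128%:R * (- (1 / 128)) :> R by field.
  by rewrite expRM_natl -[128%N]/(2 * 2 * 2 * 2 * 2 * 2 * 2)%N !exprM.
have := ler_pM _ (ltW (expR_gt0 1)) h (lexx (expR (1 : R))).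
rewrite -expRD addNr expR0 => /(_ ltac:(lra)).
by lra.
Qed.

(* [k] is close to [1 / t], so that [(1 - t) ^+ k] is close to [expR (-1)]. *)
Lemma tail_constant (n : nat) (t : R) : (1 < n)%N -> 0 < t <= 1 / 2 ->
  exists k : nat, n.-1%:R / (n.-1 + k)%:R / (1 - t) ^+ k <= expR 1 * (n%:R * t).
Proof.
move=> n1 /andP[t0 t2].
have t1 : 0 < 1 - t by lra.
have q0 : 0 <= t^-1 - 1 by rewrite subr_ge0 invf_ge1 //; lra.
pose k := Num.truncn (t^-1 - 1); exists k.
have /andP[k1 k2] := truncn_itv q0; rewrite -/k in k1 k2.
have kt : k%:R * t <= 1 - t.
  by have := ler_wpM2r (ltW t0) k1; rewrite mulrBl mulVf ?gt_eqF // mul1r.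
have kt' : 1 - 2 * t <= k%:R * t.
  have := ler_wpM2r (ltW t0) (ltW k2).
  by rewrite mulrBl mulVf ?gt_eqF // mul1r -natr1; lra.
have pk0 : 0 < (1 - t) ^+ k by rewrite exprn_gt0.
have n0 : (0 < n.-1)%N by rewrite -subn1 subn_gt0.
have nk0 : (0 : R) < (n.-1 + k)%:R by rewrite ltr0n ltn_addr.
rewrite mulrC ler_pM ?invr_ge0 ?divr_ge0 ?(ltW pk0) ?ler0n //.
  rewrite -[leRHS]invrK lef_pV2 ?posrE ?invr_gt0 ?expR_gt0 // -expRN.
  (* From 1 / (1 - t) = 1 + t / (1 - t) <= exp(t / (1 - t)) and [k * t <= 1 - t] it follows that (1
     - t)^k >= 1 / e. *)
  apply: (@le_trans _ _ (expR (- (t / (1 - t))) ^+ k)).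
    rewrite -expRM_natl ler_expR mulrN lerN2 mulrA ler_pdivrMr //.
    by rewrite mul1r.
  rewrite lerXn2r ?nnegrE ?expR_ge0 ?(ltW t1) // expRN invf_ple ?posrE ?expR_gt0 //.
  rewrite (le_trans _ (expR_ge1Dx _)) //.
  by rewrite (_ : 1 + t / (1 - t) = (1 - t)^-1) //; field; rewrite gt_eqF.
rewrite ler_pdivrMr // natrD mulrAC mulrDr.
have nE : n%:R = n.-1%:R + 1 :> R by rewrite natr1 prednK // ltnW.
have n1R : 1 <= n.-1%:R :> R by rewrite ler1n.
rewrite nE; move: (n.-1%:R) n1R => p p1.
(* With p = n - 1 the goal is p <= (p + 1) (k t + t p). By [kt'] the right side is at least p + (1 -
   2 t) + t p (p - 1). *)
have h1 : (p + 1) * (1 - 2 * t + t * p) <= (p + 1) * (k%:R * t + t * p).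
  by rewrite ler_wpM2l ?lerD2r //; lra.
have h2 : 0 <= t * (p * (p - 1)) by rewrite !mulr_ge0 ?(ltW t0) //; lra.
clear - h1 h2 t2; nra.
Qed.

End TailConstants.

(** * Overlaps with the eigenbasis and the union bound *)

Section UniformSphere.
Variables (R : realType) (n : nat) (mu : probability (borel_cV R n) R).
Hypothesis mu_sphere : mu (@csphere R n) = 1%E.
Hypothesis mu_unitary : forall U : 'M[R[i]]_n, U \is unitarymx ->
  forall E : set (borel_cV R n), measurable E ->
  mu [set x : 'cV[R[i]]_n | E (U *m x)] = mu E.
Variable phi : 'I_n -> 'cV[R[i]]_n.
Hypothesis phi_on : forall i j, inner (phi i) (phi j) = (i == j)%:R.

Definition small_overlap (t : R) (j : 'I_n) : set (borel_cV R n) :=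
  @csphere R n `&` [set x | weight phi x j < t].

Lemma weight_measurable j :
  measurable_fun setT (weight phi ^~ j : borel_cV R n -> R).
Proof. by apply: continuous_measurable_cV; exact: weight_continuous. Qed.

Lemma small_overlap_measurable t j : measurable (small_overlap t j).
Proof.
apply: measurableI; first exact: sphere_measurable.
have := weight_measurable j measurableT (measurable_itv `]-oo, t[).
by rewrite setTI; congr (measurable _); apply/seteqP.
Qed.

(** The unitary change to eigencoordinates turns the overlap with [phi j] into the j-th entry, and
    [mu] is invariant under it. *)
Lemma small_overlap_le t j k : (1 < n)%N -> 0 < t < 1 ->
  (mu (small_overlap t j) <= (n.-1%:R / (n.-1 + k)%:R / (1 - t) ^+ k)%:E)%E.
Proof.
move=> n1 t01; apply: le_trans (small_entry_le mu_sphere mu_unitary j k n1 t01).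
have mB : measurable (@csphere R n
    `&` [set x : borel_cV R n | nsq ((x : 'cV[R[i]]_n) j 0) < t]).
  apply: measurableI; first exact: sphere_measurable.
  have [mf _] := @sphere_bounded_nsq R n j.
  have := mf measurableT _ (measurable_itv `]-oo, t[).
  by rewrite setTI; congr (measurable _); apply/seteqP.
have := mu_unitary (eigmx_unitary phi_on) mB.
move=> h; rewrite le_eqVlt; apply/orP; left; apply/eqP.
rewrite -[RHS]h; congr (mu _); apply/seteqP; split=> x [xS xt]; split => //=.
  by rewrite /csphere /= (sqnorm_unitary _ (eigmx_unitary phi_on)).
by move: xS; rewrite /csphere /= (sqnorm_unitary _ (eigmx_unitary phi_on)).
Qed.

Lemma measure_bigsetU_le (I : Type) (s : seq I) (B : I -> set (borel_cV R n)) (p : R) :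
  (forall i, measurable (B i)) -> (forall i, (mu (B i) <= p%:E)%E) ->
  measurable (\big[setU/set0]_(i <- s) B i) /\
  (mu (\big[setU/set0]_(i <- s) B i) <= ((size s)%:R * p)%:E)%E.
Proof.
move=> mB hp; elim: s => [|i s [ms IH]].
  by rewrite big_nil measure0 mul0r; split.
rewrite big_cons; split; first exact: measurableU.
rewrite (le_trans (measureU2 _ _ _)) //=.
by rewrite -natr1 mulrDl mul1r addrC EFinD leeD.
Qed.

(** The sphere is covered by [E] and the [n] small-overlap events, each of mass at most e n t by
    [tail_constant]. *)
Lemma large_overlap_ge (t : R) (E : set (borel_cV R n)) :
  (1 < n)%N -> 0 < t <= 1 / 2 -> measurable E ->
  (forall x, @csphere R n x -> (forall j, t <= weight phi x j) -> E x) ->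
  ((1 - n%:R * (expR 1 * (n%:R * t)))%:E <= mu E)%E.
Proof.
move=> n1 t02 mE hE; have [k hk] := tail_constant n1 t02.
have t01 : 0 < t < 1 by move: t02 => /andP[-> ?] /=; lra.
have hp j : (mu (small_overlap t j) <= (expR 1 * (n%:R * t))%:E)%E.
  by rewrite (le_trans (small_overlap_le j k n1 t01)) // lee_fin.
have [mU hU] := measure_bigsetU_le (index_enum 'I_n) (small_overlap_measurable t) hp.
have cover : @csphere R n `<=` E `|` \big[setU/set0]_(j <- index_enum 'I_n) small_overlap t j.
  move=> x xS; have [h|] := pselect (forall j, t <= weight phi x j).
    by left; exact: hE.
  move=> /existsNP[j /negP]; rewrite -ltNge => hj; right.
  by rewrite -bigcup_seq; exists j => //=; rewrite mem_index_enum.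
rewrite EFinB leeBlDr // (le_trans (y := mu (@csphere R n))) //.
  by rewrite mu_sphere.
rewrite (le_trans (le_measure mu _ _ cover)) ?inE //.
- exact: sphere_measurable.
- exact: measurableU.
rewrite (le_trans (measureU2 _ _ _)) // leeD //.
by rewrite (le_trans hU) // lee_fin -sum1_size big_const_ord iter_addn_0 mul1n.
Qed.

End UniformSphere.

(* The outer [maxe 0] matters only when the logarithm is negative and
   [diam > 0], which forces m = 1 and n = 2: there the Krylov space is all of
   C^2, the left-hand side is 0, and the bare right-hand side would be < 0. *)
Theorem theorem3p2 (R : realType) (m n : nat) (alpha : R)
    (A : 'M[R[i]]_n) (phi : 'I_n -> 'cV[R[i]]_n)
    (hm : (0 < m)%N) (hn : (0 < n)%N) (halpha : 0 < alpha)
    (hA : A \is normalmx) (hphi : orthonormal_eigenbasis A phi) :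
  (forall b : 'cV[R[i]]_n, b != 0 -> min_overlap phi b != 0 ->
   forall (r : nat) (Q : 'M[R[i]]_(n, r)),
     krylov_orthobasis A b (6 * m + 1)%N Q ->
     (hausdorff_dist (numrange (compression Q A)) (numrange A)
      <= maxe 0
           ((6 / m%:R * ln (expR 1 * m%:R * sqnorm b
                            / (6 * min_overlap phi b ^+ 2)))%:E
            * diam (numrange A)))%E)
  /\
  (forall (d : measure_display) (T : measurableType d) (P : probability T R)
     (b : {RV P >-> borel_cV R n}), unif_sphere b ->
   forall (r : T -> nat) (Q : forall w : T, 'M[R[i]]_(n, r w)),
     (forall w : T, krylov_orthobasis A (b w) (6 * m + 1)%N (Q w)) ->
     ((1 - 5 * m%:R / (4 * n%:R `^ alpha))%:E
      <= P [set w : T |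
             hausdorff_dist (numrange (compression (Q w) A)) (numrange A)
             <= (6 * (2 + alpha) * ln n%:R / m%:R)%:E * diam (numrange A)])%E).
Proof.
have [phi_on eig] := hphi; have [lam lamE] := choice eig.
split=> [b b0 mu0 r Q hQ|d T P b [bS bU] r Q hQ].
  exact: (min_overlap_bound hn phi_on lamE hm mu0 hQ).
set C := ((6 * (2 + alpha) * ln n%:R / m%:R)%:E * diam (numrange A))%E.
have n1R : 1 <= n%:R :> R by rewrite ler1n.
have m0R : 0 < m%:R :> R by rewrite ltr0n.
have c0 : 0 <= 6 * (2 + alpha) * ln n%:R / m%:R.
  by rewrite divr_ge0 ?(ltW m0R) // mulr_ge0 ?ln_ge0 // mulr_ge0 // addr_ge0 // ltW.
have diam0 : (0 <= diam (numrange A))%E.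
  have := diam_ge (numrange_eigenvalue phi_on lamE (Ordinal hn))
                  (numrange_eigenvalue phi_on lamE (Ordinal hn)).
  by rewrite subrr cmod0.
have C0 : (0 <= C)%E by rewrite mule_ge0.
(* [Q w] depends on the outcome; a basis chosen from the vector alone makes the event a preimage
   under [b] of a Borel set. *)
pose Q' (x : 'cV[R[i]]_n) := projT1 (cid (krylov_orthobasis_exists A x (6 * m + 1))).
have hQ' x : krylov_orthobasis A x (6 * m + 1) (Q' x).
  exact: projT2 (cid (krylov_orthobasis_exists A x (6 * m + 1))).
pose E : set (borel_cV R n) :=
  [set x | (hausdorff_dist (numrange (compression (Q' x) A)) (numrange A) <= C)%E].
have mE : measurable E by exact: (hausdorff_event_measurable phi_on lamE C0 hQ').
rewrite (_ : [set w | _] = b @^-1` E); last first.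
  apply/seteqP; split=> w; rewrite /E /=;
    by rewrite (numrange_compression_unique phi_on lamE (hQ w) (hQ' (b w))).
rewrite -[P _]/(distribution P b E).
set y := m%:R / n%:R `^ alpha.
have na0 : 0 < n%:R `^ alpha :> R by rewrite powR_gt0 // ltr0n.
have y0 : 0 < y by rewrite divr_gt0.
have -> : 5 * m%:R / (4 * n%:R `^ alpha) = 5 / 4 * y by rewrite /y; field; rewrite gt_eqF.
(* If [y >= 4 / 5], the claimed lower bound on the probability is at most 0. *)
have [ylarge|ysmall] := leP (4 / 5) y.
  by rewrite (le_trans _ (measure_ge0 _ _)) // lee_fin; lra.
have n1 : (1 < n)%N.
  rewrite ltn_neqAle hn andbT; apply: contraTneq ysmall => n1.
  rewrite -leNgt /y -n1 powR1 divr1 (le_trans _ (_ : 1 <= _)) ?ler1n //; lra.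
have n2R : 2 <= n%:R :> R by rewrite (ler_nat _ 2).
(* Chosen so that e m / (6 t) = n^(2 + alpha), which turns the logarithm of the first part into (2 +
   alpha) ln n; the failure probability e n^2 t then equals e^2 y / 6. *)
pose t := expR 1 * y / (6 * n%:R ^+ 2) : R.
have nn : 4 <= n%:R ^+ 2 :> R by rewrite expr2; nra.
have nn0 : 0 < 6 * n%:R ^+ 2 :> R by lra.
have e0 := expR_gt0 (1 : R); have e3 := expR1_le R.
have t0 : 0 < t by rewrite divr_gt0 // mulr_gt0.
have t2 : t <= 1 / 2.
  have : expR 1 * y <= 3 * 1 by apply: ler_pM; rewrite ?(ltW e0) ?(ltW y0) //; lra.
  by rewrite /t ler_pdivrMr //; lra.
have powE : expR 1 * m%:R / (6 * t) = n%:R `^ (2 + alpha).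
  rewrite powRD; last by apply/implyP => _; rewrite pnatr_eq0 -lt0n.
  rewrite powR_mulrn ?ler0n // /t /y.
  by field; rewrite !gt_eqF // ltr0n.
have tE : n%:R * (expR 1 * (n%:R * t)) = expR 1 ^+ 2 / 6 * y.
  by rewrite /t; field; rewrite gt_eqF // ltr0n.
clearbody t.
have hE x : csphere x -> (forall j, t <= weight phi x j) -> E x.
  move=> xS hx; have x1 : sqnorm x = 1 by [].
  have st0 : 0 < Num.sqrt t by rewrite sqrtr_gt0.
  have hmin : Num.sqrt t <= min_overlap phi x.
    apply: min_overlap_ge => // j.
    by rewrite cmodE ler_sqrt ?nsq_ge0 //; have := hx j; rewrite /weight coordE.
  have mu0 : 0 < min_overlap phi x by rewrite (lt_le_trans st0).
  have mut : t <= min_overlap phi x ^+ 2.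
    by rewrite -[leLHS]sqr_sqrtr ?(ltW t0) // lerXn2r ?nnegrE ?(ltW st0) ?(ltW mu0).
  have := min_overlap_bound hn phi_on lamE hm (lt0r_neq0 mu0) (hQ' x).
  move/le_trans; apply; rewrite ge_max C0 /= /C lee_wpmul2r // lee_fin x1 mulr1.
  have arg0 : 0 < expR 1 * m%:R / (6 * min_overlap phi x ^+ 2).
    by rewrite divr_gt0 ?mulr_gt0 // exprn_gt0.
  have : ln (expR 1 * m%:R / (6 * min_overlap phi x ^+ 2)) <= (2 + alpha) * ln n%:R.
    have argt : 0 < expR 1 * m%:R / (6 * t).
      by apply: divr_gt0; apply: mulr_gt0.
    rewrite -ln_powR -powE ler_ln ?posrE //.
    rewrite ler_pM2l ?mulr_gt0 // lef_pV2 ?posrE ?mulr_gt0 ?exprn_gt0 //.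
    by rewrite ler_pM2l.
  move=> h; rewrite (_ : 6 * (2 + alpha) * ln n%:R / m%:R = 6 / m%:R * ((2 + alpha) * ln n%:R)).
    by rewrite ler_wpM2l // divr_ge0 // ltW.
  by ring.
apply: le_trans (large_overlap_ge bS bU phi_on n1 _ mE hE); last by rewrite t0.
rewrite lee_fin lerD2l lerN2.
rewrite tE ler_pM2r // ler_pdivrMr // expr2.
(* Since 2.735^2 < 7.5, this yields e^2 / 6 <= 5 / 4. *)
have : expR 1 * expR 1 <= ((273 + 1 / 2) / 100) * ((273 + 1 / 2) / 100) :> R.
  by apply: ler_pM => //; exact: ltW.
by lra.
Qed.
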